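(* For $t\ge 0$, the variances $v_A(t):=\mathrm{Var}\,A(t)$ and $v_S(t):=\mathrm{Var}\,S(t)$ of the cumulative arrival process $A(\cdot)$ and the cumulative potential service process $S(\cdot)$ are given by $$v_A(t)=t\cdot\mathbb{E}\Lambda+2\,\frac{\mathrm{Var}\,\Lambda}{\mathbb{E}\xi}\left(\int_0^t\big(tu-\tfrac12u^2\big)\,\mathbb{P}(\xi>u)\,\mathrm{d}u+\tfrac12t^2\int_t^\infty\mathbb{P}(\xi>u)\,\mathrm{d}u\right)$$ and $$v_S(t)=t\cdot\mathbb{E}\mathcal{M}+2\,\frac{\mathrm{Var}\,\mathcal{M}}{\mathbb{E}\xi}\left(\int_0^t\big(tu-\tfrac12u^2\big)\,\mathbb{P}(\xi>u)\,\mathrm{d}u+\tfrac12t^2\int_t^\infty\mathbb{P}(\xi>u)\,\mathrm{d}u\right).$$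
   Context: Rates are resampled at the epochs of a stationary renewal process: the inter-sample intervals are i.i.d., distributed as a non-negative random variable $\xi$ with a density and with $\mathbb{E}\xi<\infty$, $\mathbb{E}[\xi^2]<\infty$, except that the time from $0$ until the first resampling is independent of the others and has the residual lifetime distribution with density $x\mapsto\mathbb{P}(\xi>x)/\mathbb{E}\xi$. At time $0$ and at each resampling epoch a new pair (arrival rate, service rate) is drawn; these pairs are i.i.d., independent of the resampling epochs, and distributed as a componentwise non-negative random vector $(\Lambda,\mathcal{M})$ (components possibly dependent, arbitrary distribution) with $\mathrm{Var}\,\Lambda<\infty$ and $\mathrm{Var}\,\mathcal{M}<\infty$. Let $\Lambda(t)$ and $\mathcal{M}(t)$ be the arrival rate and service rate that apply at time $t$. Conditionally on $(\Lambda(s),\mathcal{M}(s))_{s\ge0}$, the cumulative arrival process $A(\cdot)$ and the cumulative potential service process $S(\cdot)$ are independent (inhomogeneous) Poisson processes with intensities $\Lambda(\cdot)$ and $\mathcal{M}(\cdot)$, respectively; in particular $A(t)$ is Poisson with (random) parameter $\int_0^t\Lambda(s)\,\mathrm{d}s$ and $S(t)$ is Poisson with (random) parameter $\int_0^t\mathcal{M}(s)\,\mathrm{d}s$. *)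

(* Defs.v *)
From HB Require Import structures.
From mathcomp Require Import all_boot all_order all_algebra finmap.
From mathcomp Require Import all_classical all_reals all_analysis.

Set Implicit Arguments.
Unset Strict Implicit.
Unset Printing Implicit Defensive.

Import Order.TTheory GRing.Theory Num.Theory.
Import numFieldNormedType.Exports.

Local Open Scope classical_set_scope.
Local Open Scope ring_scope.

Section laws.
Context d (T : measurableType d) (R : realType) (P : probability T R).

(* Equality is required on measurable sets only: the value of
   [distribution P X] elsewhere is not determined by the law of [X]. *)
Definition same_law d' (U : measurableType d') (X Y : T -> U) : Prop :=
  forall B : set U, measurable B -> P (X @^-1` B) = P (Y @^-1` B).

Definition has_density (X : T -> R) (f : R -> R) : Prop :=
  [/\ measurable_fun setT f, forall x, 0 <= f x &
      forall B : set R, measurable B ->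
        P (X @^-1` B) = (\int[lebesgue_measure]_(x in B) (f x)%:E)%E].

Definition residual_density (X : {RV P >-> R}) (x : R) : R :=
  if 0 <= x then fine (ccdf X x) / fine 'E_P[X]%E else 0.

Definition mutually_independent (I : choiceType) d' (U : measurableType d')
    (X : I -> T -> U) : Prop :=
  forall (J : {fset I}) (B : I -> set U), (forall i, measurable (B i)) ->
    P (\bigcap_(i in [set` J]) (X i @^-1` B i)) =
    (\prod_(i <- J) P (X i @^-1` B i))%E.

Definition sigma_of (I : Type) (D : set I) d' (U : measurableType d')
    (X : I -> T -> U) : set (set T) :=
  <<s \bigcup_(i in D) preimage_set_system setT (X i) measurable >>.

Definition independent_systems (F G : set (set T)) : Prop :=
  forall E1 E2, F E1 -> G E2 -> P (E1 `&` E2) = (P E1 * P E2)%E.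

(* [q] is a version of the conditional probability of [E] given the
   sigma-algebra [G]. *)
Definition cond_prob_version (G : set (set T)) (E : set T) (q : T -> R)
    : Prop :=
  (forall B : set R, measurable B -> G (q @^-1` B)) /\
  (forall H, G H -> (\int[P]_(w in H) (q w)%:E)%E = P (E `&` H)).

Definition cond_independent (G F1 F2 : set (set T)) : Prop :=
  forall E1 E2 q1 q2, F1 E1 -> F2 E2 ->
    cond_prob_version G E1 q1 -> cond_prob_version G E2 q2 ->
    cond_prob_version G (E1 `&` E2) (fun w => q1 w * q2 w).

End laws.

Section resampling.
Context (T : Type) (R : realType).

(* [tau 0] is the time until the first resampling, [tau n.+1] the interval
   between the resampling epochs number [n.+1] and [n.+2]. *)
Definition epoch (tau : nat -> T -> R) (n : nat) (w : T) : R :=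
  \sum_(0 <= i < n) tau i w.

(* The number of resamplings in [0, t], i.e. the [n] such that
   [epoch tau n w <= t < epoch tau n.+1 w]. Written as a first passage, [n] is
   unique for every [w], also where some [tau i w] is negative; the default 0
   is taken only where the epochs never exceed [t]. Both are null events. *)
Definition nb_resamplings (tau : nat -> T -> R) (t : R) (w : T) : nat :=
  xget 0%N [set n | (forall k, (k < n)%N -> epoch tau k.+1 w <= t) /\
                    t < epoch tau n.+1 w].

Definition resampled (tau L : nat -> T -> R) (t : R) (w : T) : R :=
  L (nb_resamplings tau t w) w.

End resampling.

Section poisson_process.
Context d (T : measurableType d) (R : realType) (P : probability T R).

(* [poisson_pmf r k] is 1 at [r = 0] for all [k], whereas the parameter may
   vanish here; this expression is the mass of the Dirac measure at 0 then. *)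
Definition poisson_mass (r : R) (k : nat) : R :=
  r ^+ k / k`!%:R * expR (- r).

Definition counting_path (f : R -> nat) : Prop :=
  [/\ f 0 = 0%N,
      forall s t, 0 <= s -> s <= t -> (f s <= f t)%N &
      forall s, 0 <= s -> \forall u \near s^'+, f u = f s].

(* Given the sigma-algebra [G], [N] (restricted to nonnegative times) is an
   inhomogeneous Poisson process with ([G]-measurable) intensity [lam]. *)
Definition cond_poisson_process (G : set (set T)) (N : R -> T -> nat)
    (lam : R -> T -> R) : Prop :=
  {ae P, forall w, counting_path (N ^~ w)} /\
  forall (n : nat) (t : nat -> R) (k : nat -> nat),
    0 <= t 0%N -> (forall i, (i < n)%N -> t i <= t i.+1) ->
    cond_prob_version P G
      [set w | forall i, (i < n)%N -> N (t i.+1) w = (N (t i) w + k i)%N]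
      (fun w => \prod_(i < n) poisson_mass
         (\int[lebesgue_measure]_(s in `[t i, t i.+1]) lam s w) (k i)).

End poisson_process.

(* Main.v *)
(** Given the rates, the count up to time t is Poisson with parameter
    I = \int_0^t rate, so its variance is E I + Var I.  On the j-th renewal
    interval, of length l_j inside [0, t], the rate is constant, so that
    I = sum_j L_j l_j; as the L_j are i.i.d. and independent of the l_j,
    whose sum is t, Var I = Var L * sum_j E l_j^2.
    Write K f s = E f(s + xi) and f s = E (min(xi, t - s)^+)^2, so that
    E l_(j+1)^2 = E (K^j f)(tau_0).  The residual lifetime density p / E xi,
    with p s = P(xi > s), gives
    E xi * E g(tau_0) = \int g p = \int g - \int K g over [0, +oo[,
    and the sum over j telescopes to \int f / E xi.  The remainder \int K^n f
    tends to 0 geometrically because s |-> exp(t - s) is an eigenfunction of K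
    for the eigenvalue E exp(- xi) < 1; the same eigenfunction shows that the
    epochs tend to infinity almost surely. *)

Require Import Defs.
From HB Require Import structures.
From mathcomp Require Import all_boot all_order all_algebra finmap.
From mathcomp Require Import all_classical all_reals all_analysis.
From mathcomp Require Import measurable_realfun ring lra.

Set Implicit Arguments.
Unset Strict Implicit.
Unset Printing Implicit Defensive.

Import Order.TTheory GRing.Theory Num.Theory.
Import numFieldNormedType.Exports.

Local Open Scope classical_set_scope.
Local Open Scope ring_scope.

(** * Tonelli on sets, translations and densities *)

(** The number of intervals that meet [0, t] is random and depends on their lengths. Expectations
    are therefore taken of sums with a fixed number n of terms, where rates and lengths are
    independent: with c = E L and v = Var L, E X_n^2 = c^2 E S_n^2 + v sum_(j<n) E l_j^2, where S_n
    = sum_(j<n) l_j. Almost surely X_n and S_n increase and end up constant, equal to I and t, so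
    monotone convergence applies; c^2 t^2 is then (E I)^2 and cancels in the variance. Rates and
    lengths are cut off at 0, so that everything is nonnegative everywhere and Tonelli applies in
    \bar R; finiteness enters when a remainder has to be subtracted. The bracket of the statement
    has two sources. Interval 0 contributes the integral of min(u, t)^2 p(u). All others together
    contribute \int f, which by the layer cake formula for the square is the integral of 2u (t -
    u)^+ p(u). On [0, t] the two integrands add up to u^2 + 2u(t - u) = 2(tu - u^2/2); beyond t only
    t^2 is left. The strict inequality E exp(- xi) < 1 rests on P(xi = 0) = 0, which the density
    provides. *)

Section integration_tools.
Local Open Scope ereal_scope.

Lemma tonelli_in d1 d2 (T1 : measurableType d1) (T2 : measurableType d2)
    (R : realType) (m1 : {sigma_finite_measure set T1 -> \bar R})
    (m2 : {sigma_finite_measure set T2 -> \bar R}) (D1 : set T1) (D2 : set T2)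
    (f : T1 -> T2 -> \bar R) :
  measurable D1 -> measurable D2 ->
  measurable_fun setT (fun z : T1 * T2 => f z.1 z.2) -> (forall x y, 0 <= f x y) ->
  \int[m1]_(x in D1) \int[m2]_(y in D2) f x y =
  \int[m2]_(y in D2) \int[m1]_(x in D1) f x y.
Proof.
move=> mD1 mD2 mf f0.
pose g := (fun z : T1 * T2 => f z.1 z.2) \_ (D1 `*` D2).
have mg : measurable_fun setT g.
  apply/(measurable_restrictT _ _).1 => //; first exact: measurableX.
  exact: measurable_funTS.
have g0 z : 0 <= g z by rewrite /g patchE; case: ifP.
have := fubini_tonelli (m1 := m1) (m2 := m2) g mg g0.
congr (_ = _).
  rewrite [RHS]integral_mkcond; apply: eq_integral => x _.
  rewrite patchE; case: ifPn => xD1.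
    rewrite [RHS]integral_mkcond; apply: eq_integral => y _.
    by rewrite /g !patchE in_setX xD1.
  rewrite -[RHS](integral0 m2 setT); apply: eq_integral => y _.
  by rewrite /g patchE in_setX (negbTE xD1).
rewrite [RHS]integral_mkcond; apply: eq_integral => y _.
rewrite patchE; case: ifPn => yD2.
  rewrite [RHS]integral_mkcond; apply: eq_integral => x _.
  by rewrite /g !patchE in_setX yD2 andbT.
rewrite -[RHS](integral0 m1 setT); apply: eq_integral => x _.
by rewrite /g patchE in_setX (negbTE yD2) andbF.
Qed.

Lemma measurable_fun_integral_snd d1 d2 (T1 : measurableType d1)
    (T2 : measurableType d2) (R : realType)
    (m2 : {sigma_finite_measure set T2 -> \bar R}) (f : T1 -> T2 -> \bar R) :
  measurable_fun setT (fun z : T1 * T2 => f z.1 z.2) -> (forall x y, 0 <= f x y) ->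
  measurable_fun setT (fun x => \int[m2]_y f x y).
Proof.
move=> mf f0.
exact: (measurable_fun_fubini_tonelli_F (m2 := m2) (fun z : T1 * T2 => f z.1 z.2)).
Qed.

(** The image of Lebesgue measure under the translation has the right value on half-open intervals,
    which determine the measure. *)
Lemma ge0_integral_translation (R : realType) (a : R) (f : R -> \bar R) :
  measurable_fun setT f -> (forall x, 0 <= f x) ->
  \int[lebesgue_measure]_x f (x + a)%R = \int[lebesgue_measure]_x f x.
Proof.
move=> mf f0.
have mt : measurable_fun setT ((fun x => x + a)%R : measurableTypeR R -> measurableTypeR R).
  by apply: measurable_funD.
transitivity (\int[pushforward lebesgue_measure ((fun x => x + a)%R : measurableTypeR R -> measurableTypeR R)]_x f x).
  by rewrite ge0_integral_pushforward.
apply: eq_measure_integral => A mA _.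
apply/esym/lebesgue_measure_unique => // _ [[b c]] _ <- /=.
rewrite /pushforward.
rewrite [X in _ = lebesgue_measure X](_ : _ = `](b - a)%R, (c - a)%R]%classic); last first.
  by apply/seteqP; split=> x /=; rewrite !in_itv/= => /andP[? ?];
    apply/andP; split; lra.
rewrite !lebesgue_measure_itv/= !lte_fin ltrD2r; case: ifP => // _.
by rewrite -!EFinD; congr (_%:E); lra.
Qed.

Import HBNNSimple.

(** Standard extension: indicators ([Hind]), then nonnegative simple functions ([Hs]), then
    increasing limits on both sides. *)
Lemma ge0_integral_density d d' (T : measurableType d) (U : measurableType d')
    (R : realType) (m : {measure set T -> \bar R})
    (n : {measure set U -> \bar R}) (X : T -> U) (p : U -> R) :
  measurable_fun setT X -> measurable_fun setT p -> (forall x, 0 <= p x)%R ->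
  (forall B, measurable B -> m (X @^-1` B) = \int[n]_(x in B) (p x)%:E) ->
  forall f : U -> \bar R, measurable_fun setT f -> (forall x, 0 <= f x) ->
  \int[m]_w f (X w) = \int[n]_x (f x * (p x)%:E).
Proof.
move=> mX mp p0 mXp.
have pE0 x : 0 <= (p x)%:E by rewrite lee_fin.
have mpE : measurable_fun setT (EFin \o p) by exact/measurable_EFinP.
have Hind B : measurable B ->
    \int[m]_w (\1_B (X w))%:E = \int[n]_x ((\1_B x)%:E * (p x)%:E).
  move=> mB; rewrite (eq_integral (fun w => (\1_(X @^-1` B) w)%:E)); last first.
    by move=> w _; rewrite !indicE.
  rewrite integral_indic//; last by rewrite -[X in measurable X]setTI; exact: mX.
  rewrite setIT mXp// integral_mkcond; apply: eq_integral => x _.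
  by rewrite patchE indicE; case: ifP; rewrite ?mul1e ?mul0e.
have Hs (h : {nnsfun U >-> R}) :
    \int[m]_w (h (X w))%:E = \int[n]_x ((h x)%:E * (p x)%:E).
  have mi (y : R) : measurable_fun setT (fun x => (y * \1_(h @^-1` [set y]) x)%:E).
    by apply/measurable_EFinP/measurableT_comp.
  under eq_integral do rewrite fimfunE -fsumEFin//.
  under [RHS]eq_integral.
    move=> x _; rewrite fimfunE -fsumEFin// ge0_mule_fsuml; last first.
      by move=> r; rewrite EFinM nnfun_muleindic_ge0.
    over.
  rewrite !ge0_integral_fsum//.
  - apply: eq_fsbigr => y _.
    have [y0|y0] := leP 0%R y.
      under eq_integral do rewrite EFinM.
      under [RHS]eq_integral do rewrite EFinM -muleA.
      rewrite !ge0_integralZl_EFin// ?Hind//.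
      - by move=> x _; rewrite mule_ge0// lee_fin.
      - by apply: emeasurable_funM => //; exact/measurable_EFinP.
      - by apply/measurable_EFinP; apply: measurableT_comp.
    rewrite preimage_nnfun0//.
    under eq_integral do rewrite indic0 mulr0.
    under [RHS]eq_integral do rewrite indic0 mulr0 mul0e.
    by rewrite !integral0.
  - by move=> y; apply: emeasurable_funM.
  - by move=> y x _; rewrite mule_ge0// EFinM nnfun_muleindic_ge0.
  - by move=> y; apply: (measurableT_comp (mi y)).
  - by move=> y x _; rewrite EFinM nnfun_muleindic_ge0.
move=> f mf f0; pose h := nnsfun_approx measurableT mf.
have hf x : (h n x)%:E @[n --> \oo] --> f x by exact: cvg_nnsfun_approx.
have hnd x : {homo (fun k => h k x) : a b / (a <= b)%N >-> (a <= b)%R}.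
  by move=> a b ab; exact/lefP/nd_nnsfun_approx.
transitivity (limn (fun k => \int[m]_w (h k (X w))%:E)).
  rewrite -monotone_convergence//; last 3 first.
  - by move=> k; apply/measurable_EFinP/measurableT_comp.
  - by move=> k w _; rewrite lee_fin.
  - by move=> w _ a b ab; rewrite lee_fin hnd.
  by apply: eq_integral => w _; apply/esym/cvg_lim.
under eq_fun do rewrite Hs.
rewrite -monotone_convergence//; last 3 first.
- by move=> k; apply: emeasurable_funM => //; exact/measurable_EFinP.
- by move=> k w _; rewrite mule_ge0// lee_fin.
- by move=> w _ a b ab; rewrite lee_wpmul2r// lee_fin hnd.
apply: eq_integral => x _; apply/cvg_lim => //.
by apply: cvgeZr.
Qed.

End integration_tools.

(** * Independence *)

Section independence.
Local Open Scope ereal_scope.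

Lemma finite_measure_prod_unique d1 d2 (U : measurableType d1)
    (V : measurableType d2) (R : realType)
    (m1 m2 : {measure set (U * V) -> \bar R}) :
  (forall A B, measurable A -> measurable B -> m1 (A `*` B) = m2 (A `*` B)) ->
  m1 setT < +oo -> forall Z, measurable Z -> m1 Z = m2 Z.
Proof.
move=> m12 m1oo Z mZ.
pose G : set (set (U * V)) :=
  [set C | exists A, measurable A /\ exists B, measurable B /\ C = A `*` B].
apply: (measure_unique G (fun=> setT)) => //.
- rewrite measurable_prod_measurableType //; congr (<<s _ >>).
  rewrite predeqE; split => [[A mA [B mB <-]]|[A [mA [B [mB ->]]]]].
    by exists A; split => //; exists B.
  by exists A => //; exists B.
- move=> /= _ _ [X1 [mX1 [X2 [mX2 ->]]]] [Y1 [mY1 [Y2 [mY2 ->]]]].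
  rewrite -setXI; exists (X1 `&` Y1); split; first exact: measurableI.
  by exists (X2 `&` Y2); split => //; exact: measurableI.
- by move=> _; exists setT; split=> //; exists setT; split=> //; rewrite setXTT.
- by rewrite bigcup_const//; exists 0%N.
- by move=> A [A1 [mA1 [A2 [mA2 ->]]]]; rewrite m12.
Qed.

Context d (T : measurableType d) (R : realType) (P : probability T R).

(** Independence makes the joint law the product of the marginal laws, as both agree on rectangles;
    Tonelli for the product does the rest. *)
Lemma ge0_integral_indep d1 d2 (U : measurableType d1) (V : measurableType d2)
    (X : {RV P >-> U}) (Y : {RV P >-> V}) (h : U -> V -> \bar R) :
  (forall A B, measurable A -> measurable B ->
     P (X @^-1` A `&` Y @^-1` B) = P (X @^-1` A) * P (Y @^-1` B)) ->
  measurable_fun setT (fun z : U * V => h z.1 z.2) -> (forall x y, 0 <= h x y) ->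
  \int[P]_w h (X w) (Y w) = \int[P]_w \int[P]_v h (X w) (Y v).
Proof.
move=> XY mh h0.
have mXY : measurable_fun setT (fun w => (X w, Y w)).
  by apply/measurable_fun_pairP; split; exact: measurable_funPT.
transitivity (\int[pushforward P (fun w => (X w, Y w))]_z h z.1 z.2).
  by rewrite ge0_integral_pushforward.
transitivity (\int[distribution P X \x distribution P Y]_z h z.1 z.2).
  apply: eq_measure_integral => Z mZ _; apply: finite_measure_prod_unique => //.
    move=> A B mA mB; rewrite [RHS]product_measure1E// -[RHS]XY//.
  by rewrite /= /pushforward preimage_setT probability_setT ltry.
rewrite (fubini_tonelli1 (fun z => h z.1 z.2))// /fubini_F /=.
rewrite ge0_integral_distribution//=; last 2 first.
  exact: (measurable_fun_integral_snd (distribution P Y)).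
  by move=> x; exact: integral_ge0.
apply: eq_integral => w _ /=.
rewrite ge0_integral_distribution//.
exact: (measurableT_comp mh (measurable_pair1 (X w))).
Qed.

(** As functions of [Z], both sides are finite measures: the law of the pair under [P] restricted to
    [E], and the law of the pair scaled by [P E]. Agreement on rectangles is therefore enough. It
    serves to treat a sum [X + Y] as one variable. *)
Lemma indep_event_pair d1 d2 (U : measurableType d1) (V : measurableType d2)
    (X : {RV P >-> U}) (Y : {RV P >-> V}) (E : set T) :
  measurable E ->
  (forall A B, measurable A -> measurable B ->
     P (X @^-1` A `&` Y @^-1` B `&` E) = P (X @^-1` A `&` Y @^-1` B) * P E) ->
  forall Z, measurable Z ->
    P ((fun w => (X w, Y w)) @^-1` Z `&` E) =
    P ((fun w => (X w, Y w)) @^-1` Z) * P E.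
Proof.
move=> mE XYE Z mZ.
have mXY : measurable_fun setT (fun w => (X w, Y w)).
  by apply/measurable_fun_pairP; split; exact: measurable_funPT.
have PEfin : P E \is a fin_num by exact: fin_num_measure.
have PE0 : (0 <= fine (P E))%R by exact: fine_ge0.
pose law (m : {measure set T -> \bar R}) : {measure set (U * V) -> \bar R} :=
  measure_function_pushforward__canonical__measure_function_Measure m mXY.
transitivity (mscale (NngNum PE0) (law P) Z);
  last by rewrite /= /mscale /= fineK// muleC.
rewrite -[LHS]/(law (mrestr P mE) Z).
apply: finite_measure_prod_unique => //.
  by move=> A B mA mB; rewrite /= /mscale /= fineK// muleC -XYE.
rewrite /= /pushforward preimage_setT /mrestr setTI.
by rewrite (le_lt_trans (probability_le1 P mE))// ltry.
Qed.

Lemma measurable_epoch (tau : nat -> {RV P >-> R}) n :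
  measurable_fun setT (epoch tau n).
Proof. by apply: measurable_sum => i. Qed.

Lemma epochS (tau : nat -> T -> R) n w :
  epoch tau n.+1 w = (epoch tau n w + tau n w)%R.
Proof. by rewrite /epoch big_nat_recr. Qed.

Lemma epoch0 (tau : nat -> T -> R) w : epoch tau 0 w = 0%R.
Proof. by rewrite /epoch big_geq. Qed.

(** The claim is made for whole finite families of later intervals because the induction moves
    [tau n] from the family into the epoch: independence of [epoch n.+1] from [J] needs that of
    [epoch n] from [J] with [n] added. *)
Lemma epoch_indep_later (tau : nat -> {RV P >-> R}) :
  mutually_independent P (fun n w => tau n w) ->
  forall n (J : {fset nat}) (B : nat -> set R), (forall i, measurable (B i)) ->
  (forall i, i \in J -> (n <= i)%N) ->
  forall C, measurable C ->
  P (epoch tau n @^-1` C `&` \bigcap_(i in [set` J]) (tau i @^-1` B i)) =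
  P (epoch tau n @^-1` C) * P (\bigcap_(i in [set` J]) (tau i @^-1` B i)).
Proof.
move=> tau_indep; elim=> [|n IH] J B mB nJ C mC.
  have [C0|C0] := pselect (C 0%R).
    rewrite (_ : epoch tau 0 @^-1` C = setT); last first.
      by apply/seteqP; split=> // w _ /=; rewrite epoch0.
    by rewrite setTI probability_setT mul1e.
  rewrite (_ : epoch tau 0 @^-1` C = set0); last first.
    by apply/seteqP; split=> // w /=; rewrite epoch0.
  by rewrite set0I measure0 mul0e.
set E := \bigcap_(_ in _) _.
have mtau i D : measurable D -> measurable (tau i @^-1` D).
  by move=> mD; rewrite -[X in measurable X]setTI; exact: measurable_funPT.
have mE : measurable E by apply: bigcap_measurableType => // i _; exact: mtau.
have nJn : n \notin J by apply/negP => /nJ; rewrite ltnn.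
have split_n B' : measurable B' ->
    tau n @^-1` B' `&` E = \bigcap_(i in [set` (n |` J)%fset])
      (tau i @^-1` (if i == n then B' else B i)).
  move=> mB'; apply/seteqP; split=> w /=.
    move=> [Bw Ew] i /=; rewrite in_fset1U; have [->//|_ /=] := eqVneq i n.
    exact: Ew.
  move=> Hw; split.
    by have := Hw n; rewrite /= in_fset1U !eqxx => /(_ isT).
  move=> i /= iJ; have := Hw i; rewrite /= in_fset1U iJ orbT => /(_ isT).
  by case: eqVneq => // iE; rewrite -iE iJ in nJn.
have Etau B' : measurable B' ->
    P (tau n @^-1` B' `&` E) = P (tau n @^-1` B') * P E.
  move=> mB'; rewrite split_n// (tau_indep _ (fun i => if i == n then B' else B i)).
    rewrite big_fsetU1//= eqxx; congr (_ * _).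
    rewrite tau_indep//; apply: eq_big_seq => i iJ.
    by case: eqVneq => // iE; rewrite -iE iJ in nJn.
  by move=> i; case: ifP.
have mX : measurable_fun setT (epoch tau n) by exact: measurable_epoch.
pose X : {RV P >-> R} := mfun_Sub (mem_set mX : _ \in mfun).
have H := @indep_event_pair _ _ _ _ X (tau n) E mE.
(* The epoch [n.+1] lies in [C] exactly when the pair (epoch [n], interval [n]) lies in the preimage
   of [C] under addition, so rectangles can be tested instead. *)
pose Z : set (R * R) := (fun z => z.1 + z.2)%R @^-1` C.
have mZ : measurable Z.
  rewrite -[X in measurable X]setTI.
  by apply: (measurable_funD (f := fst) (g := snd)) => //; exact: measurableT.
have -> : epoch tau n.+1 @^-1` C = (fun w => (X w, tau n w)) @^-1` Z.
  by apply/seteqP; split=> w /=; rewrite epochS.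
apply: H => // A B' mA mB'.
rewrite -setIA split_n//.
(* The induction hypothesis is used twice: here with [n] added to [J], and below with [n] alone to
   recombine the epoch with its next interval. *)
have IHJ := IH (n |` J)%fset (fun i => if i == n then B' else B i) _ _ A mA.
rewrite [LHS]IHJ; last 2 first.
- by move=> i; case: ifP.
- by move=> i; rewrite in_fset1U => /predU1P[->//|/nJ/ltnW].
rewrite -split_n// Etau// muleA; congr (_ * _).
have := IH [fset n]%fset (fun=> B') _ _ A mA.
have -> : \bigcap_(i in [set` [fset n]%fset]) (tau i @^-1` B') = tau n @^-1` B'.
  apply/seteqP; split=> w /=.
    by move=> /(_ n); apply; rewrite /= in_fset1.
  by move=> Bw i /=; rewrite in_fset1 => /eqP ->.
by move=> -> // i; rewrite in_fset1 => /eqP ->.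
Qed.

Lemma epoch_indep (tau : nat -> {RV P >-> R}) :
  mutually_independent P (fun n w => tau n w) ->
  forall n A B, measurable A -> measurable B ->
  P (epoch tau n @^-1` A `&` tau n @^-1` B) =
  P (epoch tau n @^-1` A) * P (tau n @^-1` B).
Proof.
move=> tau_indep n A B mA mB.
have := epoch_indep_later tau_indep (J := [fset n]%fset) (B := fun=> B)
  (fun=> mB) _ mA.
have -> : \bigcap_(i in [set` [fset n]%fset]) (tau i @^-1` B) = tau n @^-1` B.
  apply/seteqP; split=> w /=.
    by move=> /(_ n); apply; rewrite /= in_fset1.
  by move=> Bw i /=; rewrite in_fset1 => /eqP ->.
by apply=> i; rewrite in_fset1 => /eqP ->.
Qed.

Lemma same_law_ge0_integral d1 (U : measurableType d1) (X Y : {RV P >-> U})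
    (f : U -> \bar R) :
  same_law P X Y -> measurable_fun setT f -> (forall x, 0 <= f x) ->
  \int[P]_w f (X w) = \int[P]_w f (Y w).
Proof.
move=> XY mf f0.
rewrite -(ge0_integral_distribution X)// -(ge0_integral_distribution Y)//.
by apply: eq_measure_integral => A mA _; exact: XY.
Qed.

End independence.

(** * Mixed Poisson variables *)

Section mixed_poisson.
Local Open Scope ereal_scope.

Lemma poisson_mass_ge0 (R : realType) (r : R) k :
  (0 <= r)%R -> (0 <= poisson_mass r k)%R.
Proof.
move=> r0; rewrite /poisson_mass mulr_ge0 ?expR_ge0//.
by rewrite divr_ge0// exprn_ge0.
Qed.

(** Terms with k < j vanish; after a shift by j, the falling factorial cancels against k! and leaves
    r^j exp(- r) times the exponential series. *)
Lemma poisson_mass_factorial_moment (R : realType) (r : R) j : (0 <= r)%R ->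
  \sum_(k <oo) ((k ^_ j)%:R * poisson_mass r k)%:E = (r ^+ j)%:E.
Proof.
move=> r0.
have u0 k : 0 <= ((k ^_ j)%:R * poisson_mass r k)%:E.
  by rewrite lee_fin mulr_ge0// poisson_mass_ge0.
rewrite (nneseries_split 0 j)//= add0n big1_seq ?add0e; last first.
  move=> k; rewrite mem_index_iota => /andP[_ kj].
  by rewrite ffact_small// mul0r.
rewrite -nneseries_addn//.
transitivity (\sum_(k <oo) ((r ^+ j * expR (- r))%:E * (exp_coeff r k)%:E)).
  apply: eq_eseriesr => k _; rewrite -EFinM; congr (_%:E).
  rewrite /poisson_mass /exp_coeff /= -(@ffact_fact (k + j) j) ?leq_addl//.
  rewrite addnK natrM exprD.
  have h1 : (((k + j) ^_ j)%:R : R) != 0%R.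
    by rewrite pnatr_eq0 -lt0n ffact_gt0 leq_addl.
  have h2 : (k`!%:R : R) != 0%R by rewrite pnatr_eq0 -lt0n fact_gt0.
  by field; rewrite h1 h2.
rewrite nneseriesZl; last by move=> k _; rewrite lee_fin exp_coeff_ge0.
have -> : \sum_(k <oo) (exp_coeff r k)%:E = (expR r)%:E.
  rewrite /expR -EFin_lim; last exact: is_cvg_series_exp_coeff.
  by apply/congr_lim/funext => n /=; rewrite /series/= sumEFin.
by rewrite -EFinM expRN -mulrA mulVf ?gt_eqF ?expR_gt0// mulr1.
Qed.

Context d (T : measurableType d) (R : realType) (P : probability T R).

Lemma ge0_integral_nat (N : {RV P >-> nat}) (g : nat -> R) :
  (forall k, 0 <= g k)%R ->
  \int[P]_w (g (N w))%:E = \sum_(k <oo) (g k)%:E * P (N @^-1` [set k]).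
Proof.
move=> g0.
have mN k : measurable (N @^-1` [set k]).
  by rewrite -[X in measurable X]setTI; exact: measurable_funPT.
transitivity (\int[P]_w \sum_(k <oo) ((g k)%:E * (\1_(N @^-1` [set k]) w)%:E)).
  apply: eq_integral => w _.
  rewrite (nneseriesD1 (n := N w))//; last first.
    by move=> k _; rewrite mule_ge0// lee_fin.
  rewrite indicE mem_set// mule1 eseries0 ?adde0// => k _ /= kN.
  by rewrite indicE memNset ?mule0//= => NE; rewrite NE eqxx in kN.
rewrite integral_nneseries//; last 2 first.
- move=> k; apply: emeasurable_funM => //.
  exact/measurable_EFinP.
- by move=> k w _; rewrite mule_ge0// lee_fin.
apply: eq_eseriesr => k _.
rewrite ge0_integralZl_EFin//; last exact/measurable_EFinP.
by rewrite integral_indic// setIT.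
Qed.

Lemma measurable_poisson_mass k :
  measurable_fun setT (fun r : R => poisson_mass r k).
Proof.
apply: measurable_funM; last exact: measurableT_comp.
by apply: measurable_funM => //; exact: exprn_measurable.
Qed.

(** Sum over k and expectation can be exchanged by nonnegativity. The cases j = 1, 2 give E N = E I
    and E N(N - 1) = E I^2, the origin of E I + Var I. *)
Lemma mixed_poisson_factorial_moment (N : {RV P >-> nat}) (r : T -> R) j :
  measurable_fun setT r -> (forall w, 0 <= r w)%R ->
  (forall k, P (N @^-1` [set k]) = \int[P]_w (poisson_mass (r w) k)%:E) ->
  \int[P]_w ((N w ^_ j)%:R)%:E = \int[P]_w (r w ^+ j)%:E.
Proof.
move=> mr r0 Nr.
have mpm k : measurable_fun setT (fun w => (poisson_mass (r w) k)%:E).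
  exact/measurable_EFinP/(measurableT_comp (measurable_poisson_mass k)).
rewrite (ge0_integral_nat N (g := fun k => (k ^_ j)%:R))//.
transitivity (\sum_(k <oo) \int[P]_w ((k ^_ j)%:R * poisson_mass (r w) k)%:E).
  apply: eq_eseriesr => k _; rewrite Nr -ge0_integralZl_EFin//.
  by move=> w _; rewrite lee_fin poisson_mass_ge0.
rewrite -integral_nneseries//.
- by apply: eq_integral => w _; rewrite poisson_mass_factorial_moment.
- move=> k; under eq_fun do rewrite EFinM.
  exact: emeasurable_funM.
- by move=> k w _; rewrite lee_fin mulr_ge0// poisson_mass_ge0.
Qed.

End mixed_poisson.

(** * Sample paths of the resampled rate *)

Section clip.
Context {R : realType}.

(** With [a = tau j w] and [x = t - epoch tau j w] this is the length inside [0, t] of the interval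
    number [j]; the outer maximum gives 0 when the interval starts after t. *)
Definition clip (a x : R) : R := Num.max 0 (Num.min a x).

Lemma clip_ge0 a x : 0 <= clip a x.
Proof. by rewrite /clip le_max lexx. Qed.

Lemma measurable_clip : measurable_fun setT (fun z : R * R => clip z.1 z.2).
Proof. by apply: measurable_maxr => //; exact: measurable_minr. Qed.

End clip.

Definition first_passage (T : Type) (R : realType) (tau : nat -> T -> R) (s : R)
    (w : T) : set nat :=
  [set n | (forall k, (k < n)%N -> epoch tau k.+1 w <= s) /\
           s < epoch tau n.+1 w].

Lemma first_passage_unique (T : Type) (R : realType) (tau : nat -> T -> R) s w
    i j : first_passage tau s w i -> first_passage tau s w j -> i = j.
Proof.
move=> [Hi si] [Hj sj]; have [ij|ji|//] := ltngtP i j.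
  by have := lt_le_trans si (Hj _ ij); rewrite ltxx.
by have := lt_le_trans sj (Hi _ ji); rewrite ltxx.
Qed.

Section sample_path.
Context (T : Type) (R : realType) (tau L : nat -> T -> R) (w : T).
Hypothesis tau_ge0 : forall i, 0 <= tau i w.

Let S n := epoch tau n w.

Let S0 : S 0 = 0. Proof. by rewrite /S /epoch big_geq. Qed.

Let SS n : S n.+1 = S n + tau n w.
Proof. by rewrite /S /epoch big_nat_recr. Qed.

Let S_ge0 n : 0 <= S n.
Proof. by rewrite /S /epoch sumr_ge0. Qed.

Lemma nondecreasing_epoch :
  {homo (fun n => epoch tau n w) : m n / (m <= n)%N >-> m <= n}.
Proof.
rewrite -/S.
apply: homo_leq => [//|? ? ?|n]; first exact: le_trans.
by rewrite SS lerDl.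
Qed.

Lemma nb_resamplings_eq s j :
  epoch tau j w <= s < epoch tau j.+1 w -> nb_resamplings tau s w = j.
Proof.
move=> /andP[js sj1].
have Hj : first_passage tau s w j.
  by split=> // k kj; apply: le_trans js; exact: nondecreasing_epoch.
by apply: (xget_unique _ Hj) => k Hk; exact: first_passage_unique Hk Hj.
Qed.

Lemma current_interval n s : 0 <= s -> s < epoch tau n w ->
  exists2 j, (j < n)%N & epoch tau j w <= s < epoch tau j.+1 w.
Proof.
move=> s0 sn; have ex : exists m, s < S m by exists n.
case: (ex_minnP ex) => -[|j]; first by rewrite S0 ltNge s0.
move=> sj1 minj; exists j; first exact: minj.
rewrite sj1 andbT leNgt; apply/negP => /minj.
by rewrite ltnn.
Qed.

Lemma lebesgue_measure_clip t j : 0 <= t ->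
  lebesgue_measure (`[epoch tau j w, epoch tau j.+1 w[ `&` `[0, t]) =
  (clip (tau j w) (t - epoch tau j w))%:E :> \bar R.
Proof.
move=> t0; rewrite -/(S j) -/(S j.+1) /clip.
have := S_ge0 j; have := tau_ge0 j; have := SS j.
move: (S j) (S j.+1) (tau j w) => a b x -> x0 a0.
have [ta|at_] := ltP t a.
  rewrite (_ : _ `&` _ = set0); last first.
    by apply/seteqP; split=> // s [] /=; rewrite !in_itv/=; lra.
  rewrite measure0; congr (_%:E).
  by rewrite minEle; case: ifPn => ?; rewrite maxEle; case: ifPn => ?; lra.
have [axt|tax] := leP (a + x) t.
  rewrite (_ : _ `&` _ = `[a, a + x[%classic); last first.
    apply/seteqP; split=> s /=; first by case.
    by rewrite !in_itv/= => /andP[? ?]; split; apply/andP; split => //; lra.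
  rewrite lebesgue_measure_itv/= lte_fin -EFinD.
  have -> : Num.max 0 (Num.min x (t - a)) = x.
    by rewrite minEle; case: ifPn => ?; rewrite maxEle; case: ifPn => ?; lra.
  by case: ifPn => ?; congr (_%:E); lra.
rewrite (_ : _ `&` _ = `[a, t]%classic); last first.
  apply/seteqP; split=> s /=; rewrite !in_itv/=.
    by move=> [/andP[? ?] /andP[? ?]]; apply/andP.
  by move=> /andP[? ?]; split; apply/andP; split => //; lra.
rewrite lebesgue_measure_itv/= lte_fin -EFinD.
have -> : Num.max 0 (Num.min x (t - a)) = t - a.
  by rewrite minEle; case: ifPn => ?; rewrite maxEle; case: ifPn => ?; lra.
by case: ifPn => ?; congr (_%:E); lra.
Qed.

(** Every [n] with [t < epoch tau n w] will do, since later intervals do not meet [0, t]. Hence the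
    partial sums are constant from some [n] on, which is how a fixed number of terms can replace the
    random one. *)
Lemma integral_resampled n t : (forall i, 0 <= L i w) ->
  0 <= t -> t < epoch tau n w ->
  (\int[lebesgue_measure]_(s in `[0%R, t]) (resampled tau L s w)%:E)%E =
  (\sum_(j < n) L j w * clip (tau j w) (t - epoch tau j w))%:E.
Proof.
move=> L0 t0 tn.
transitivity (\int[lebesgue_measure]_(s in `[0%R, t]) \sum_(j < n)
    ((L j w)%:E * (\1_(`[epoch tau j w, epoch tau j.+1 w[%classic) s)%:E))%E.
  apply: eq_integral => s; rewrite inE/= in_itv/= => /andP[s0 st].
  have [j jn jE] := current_interval s0 (le_lt_trans st tn).
  rewrite /resampled (nb_resamplings_eq jE) (bigD1 (Ordinal jn))//=.
  rewrite indicE mem_set/= ?in_itv//= mule1 big1 ?adde0// => i /negP ij.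
  (* Any other interval containing [s] would also have [nb_resamplings] at [s] as its index, so all
     other indicators vanish. *)
  rewrite indicE memNset ?mule0//= in_itv/= => iE; apply: ij.
  apply/eqP/val_inj => /=; rewrite -(nb_resamplings_eq jE).
  by rewrite (nb_resamplings_eq iE).
rewrite ge0_integral_sum//; last 2 first.
- move=> j; apply/measurable_funTS/emeasurable_funM => //.
  exact/measurable_EFinP.
- by move=> j s _; rewrite mule_ge0// lee_fin.
rewrite -sumEFin; apply: eq_bigr => j _.
rewrite ge0_integralZl_EFin//; last exact/measurable_funTS/measurable_EFinP.
by rewrite integral_indic//= lebesgue_measure_clip.
Qed.

End sample_path.

(** * One renewal step *)

Section renewal_step.
Local Open Scope ereal_scope.
Context d (T : measurableType d) (R : realType) (P : probability T R).
Variable xi : {RV P >-> R}.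
Hypothesis xi_ge0 : {ae P, forall w, (0 <= xi w)%R}.

Let mu := @lebesgue_measure R.

Definition renewal_step (f : R -> \bar R) (s : R) : \bar R :=
  \int[P]_w f (s + xi w)%R.

Lemma renewal_step_ge0 f : (forall s, 0 <= f s) ->
  forall s, 0 <= renewal_step f s.
Proof. by move=> f0 s; exact: integral_ge0. Qed.

Lemma measurable_renewal_step f : measurable_fun setT f ->
  (forall s, 0 <= f s) -> measurable_fun setT (renewal_step f).
Proof.
move=> mf f0.
apply: (measurable_fun_integral_snd P (f := fun (s : R) (w : T) => f (s + xi w)%R)) => //.
apply: measurableT_comp => //; apply: measurable_funD => //.
exact: measurableT_comp.
Qed.

Lemma iter_renewal_step n f : measurable_fun setT f ->
  (forall s, 0 <= f s) ->
  measurable_fun setT (iter n renewal_step f) /\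
  (forall s, 0 <= iter n renewal_step f s).
Proof.
move=> mf f0; elim: n => //= n [mK K0]; split.
  exact: measurable_renewal_step.
exact: renewal_step_ge0.
Qed.

Lemma cdf_lt0 r : (r < 0)%R -> cdf xi r = 0.
Proof.
move=> r0; case: xi_ge0 => N [mN PN HN].
apply/eqP; rewrite eq_le measure_ge0 andbT -PN.
rewrite [leLHS](_ : _ = P (xi @^-1` `]-oo, r]))//.
rewrite le_measure ?inE//.
  by rewrite -[X in measurable X]setTI; exact: measurable_funPT.
move=> w /=; rewrite in_itv/= => wr; apply: HN => /= w0.
by have := lt_le_trans (le_lt_trans wr r0) w0; rewrite ltxx.
Qed.

(** For fixed [w] the substitution r = s + xi turns the domain s >= 0 into r >= xi; integrating that
    indicator over [w] yields P(xi <= r). Negative r contribute nothing because the distribution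
    function vanishes there. *)
Lemma integral_renewal_step f : measurable_fun setT f ->
  (forall s, 0 <= f s) ->
  \int[mu]_(s in `[0%R, +oo[) renewal_step f s =
  \int[mu]_(s in `[0%R, +oo[) (f s * cdf xi s).
Proof.
move=> mf f0.
pose D : set R := `[0%R, +oo[%classic.
have mD : measurable D by exact: measurable_itv.
have mind : measurable_fun setT (fun z : T * R => (\1_D (z.2 - xi z.1)%R)%:E : \bar R).
  apply/measurable_EFinP; apply: measurableT_comp => //.
  by apply: measurable_funB => //; exact: measurableT_comp.
rewrite /renewal_step.
rewrite -(tonelli_in P (@lebesgue_measure R) (f := fun (w : T) (s : R) => f (s + xi w)%R))//; last first.
  apply: measurableT_comp => //; apply: measurable_funD => //.
  exact: measurableT_comp.
transitivity (\int[P]_w \int[mu]_r (f r * (\1_D (r - xi w)%R)%:E)).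
  apply: eq_integral => w _.
  rewrite -(ge0_integral_translation (xi w) (f := fun r => f r * (\1_D (r - xi w)%R)%:E)).
  - rewrite integral_mkcond; apply: eq_integral => s _.
    by rewrite epatch_indic addrK.
  - apply: emeasurable_funM => //.
    exact: (measurableT_comp mind (measurable_pair1 w)).
  - by move=> r; rewrite mule_ge0// lee_fin.
rewrite (tonelli_in P (@lebesgue_measure R) (f := fun (w : T) (r : R) => f r * (\1_D (r - xi w)%R)%:E))//; last 2 first.
- by apply: emeasurable_funM => //; exact: measurableT_comp.
- by move=> w r; rewrite mule_ge0// lee_fin.
rewrite [RHS]integral_mkcond; apply: eq_integral => r _.
rewrite ge0_integralZl//; last first.
- exact: (measurableT_comp mind (measurable_pair2 r)).
have -> : \int[P]_w (\1_D (r - xi w)%R)%:E = cdf xi r.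
  rewrite (eq_integral (fun w => (\1_(xi @^-1` `]-oo, r]) w)%:E)); last first.
    move=> w _; rewrite !indicE; congr ((nat_of_bool _)%:R%:E); apply/idP/idP.
      by rewrite !inE /D/= !in_itv/= ?andbT ?subr_ge0.
    by rewrite !inE /D/= !in_itv/= ?andbT ?subr_ge0.
  rewrite integral_indic ?setIT//.
  by rewrite -[X in measurable X]setTI; exact: measurable_funPT.
rewrite patchE; case: ifPn => //; rewrite notin_setE/= in_itv/= andbT => /negP.
by rewrite -ltNge => r0; rewrite cdf_lt0// mule0.
Qed.

(* The measure with density P(xi > s) on [0, +oo[, pushed by one more renewal
   interval, gives the complementary density P(xi <= s): iterating shows that
   the delayed renewal process has the uniform renewal measure ds / E xi. *)
Lemma renewal_stationarity f : measurable_fun setT f ->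
  (forall s, 0 <= f s) ->
  \int[mu]_(s in `[0%R, +oo[) (f s * ccdf xi s) +
  \int[mu]_(s in `[0%R, +oo[) renewal_step f s =
  \int[mu]_(s in `[0%R, +oo[) f s.
Proof.
move=> mf f0; rewrite integral_renewal_step// -ge0_integralD//.
- by apply: eq_integral => s _; rewrite -ge0_muleDr// ccdf_cdf_1 mule1.
- by move=> s _; rewrite mule_ge0.
- by apply/measurable_funTS/emeasurable_funM => //; exact: ccdf_measurable.
- by move=> s _; rewrite mule_ge0.
- by apply/measurable_funTS/emeasurable_funM => //; exact: cdf_measurable.
Qed.

End renewal_step.

(** * Layer cake formula for the squared length *)

Section clip_integrals.
Local Open Scope ereal_scope.
Context {R : realType}.
Let mu := @lebesgue_measure R.

(** The indicator of u < x, written through the difference x - u so that joint measurability in (u,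
    x) follows by composition. *)
Definition lt_indic (u x : R) : \bar R :=
  (\1_(`]0%R, +oo[%classic : set R) (x - u)%R)%:E.

Lemma lt_indicE u x : lt_indic u x = ((u < x)%R%:R)%:E.
Proof. by rewrite /lt_indic indicE mem_setE in_itv/= andbT subr_gt0. Qed.

Lemma lt_indic_ge0 u x : 0 <= lt_indic u x.
Proof. by rewrite lt_indicE lee_fin. Qed.

Lemma measurable_lt_indic :
  measurable_fun setT (fun z : R * R => lt_indic z.1 z.2).
Proof.
by apply/measurable_EFinP/measurableT_comp => //; exact: measurable_funB.
Qed.

(** The square of b = min(a, x)^+ is the integral of 2u over 0 <= u < b, and u < min(a, x) splits
    into a product of two indicators. The absolute value keeps the integrand nonnegative on the
    whole line, as [tonelli_in] requires. *)
Lemma sqr_clipE (a x : R) :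
  (clip a x ^+ 2)%:E = \int[mu]_(u in `[0%R, +oo[)
     ((2 * `|u|)%:E * (lt_indic u a * lt_indic u x)).
Proof.
set b := clip a x.
have b0 : (0 <= b)%R by exact: clip_ge0.
have -> : (b ^+ 2)%:E = \int[mu]_(u in `[0%R, b]) (2 * u)%:E.
  have [<-|bn0] := eqVneq 0%R b.
    by rewrite set_itv1 integral_set1 expr0n.
  have b_gt0 : (0 < b)%R by rewrite lt_neqAle bn0.
  rewrite (@continuous_FTC2 R (fun u => 2 * u)%R (fun u => u ^+ 2)%R)//.
  - by rewrite expr0n sube0.
  - apply: continuous_subspaceT => u.
    by apply: cvgM; [exact: cvg_cst|exact: cvg_id].
  - split.
    + by move=> u _; exact: exprn_derivable.
    + by apply: cvg_at_right_filter; exact: exprn_continuous.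
    + by apply: cvg_at_left_filter; exact: exprn_continuous.
  - move=> u _; rewrite derive1E exp_derive.
    by rewrite expr1 scaler1 -mulr_natl.
rewrite -integral_itv_bndo_bndc; last first.
  by apply/measurable_EFinP/measurable_funTS/measurable_funM.
rewrite [LHS]integral_mkcond [RHS]integral_mkcond; apply: eq_integral => u _.
rewrite !patchE !lt_indicE !mem_setE !in_itv/= !andbT.
have [u0|u0]/= := leP 0%R u; last by [].
rewrite /b /clip lt_max ltNge u0/= lt_min ger0_norm//.
by case: (u < a)%R; case: (u < x)%R; rewrite ?mule1 ?mul0e ?mule0.
Qed.

Lemma integral_lt_indic (t u : R) :
  \int[mu]_(s in `[0%R, +oo[) lt_indic u (t - s) = (Num.max 0 (t - u))%:E.
Proof.
transitivity (\int[mu]_(s in `[0%R, +oo[)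
    (\1_(`]-oo, (t - u)%R[%classic : set R) s)%:E).
  by apply: eq_integral => s _; rewrite lt_indicE indicE mem_setE in_itv/= !ltrBrDr addrC.
rewrite integral_indic//=.
rewrite (_ : _ `&` _ = `[0%R, (t - u)%R[%classic); last first.
  apply/seteqP; split=> s /=; rewrite !in_itv/= andbT.
    by move=> [-> ->].
  by move=> /andP[-> ->].
rewrite lebesgue_measure_itv/= lte_fin; case: ltP => _ //.
by rewrite sube0.
Qed.

(** The integrand is exp(t) times the density of the exponential law with rate 1. *)
Lemma integral_expN (t : R) :
  \int[mu]_(s in `[0%R, +oo[) (expR (t - s))%:E <= (expR t)%:E.
Proof.
have H : \int[mu]_x (exponential_pdf 1 x)%:E = 1 :> \bar R.
  exact: integral_exponential_pdf.
rewrite -[leRHS]mule1 -[X in _ * X]H.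
rewrite -ge0_integralZl_EFin ?expR_ge0//; last 2 first.
- by move=> x _; rewrite lee_fin exponential_pdf_ge0.
- by apply/measurable_EFinP; exact: measurable_exponential_pdf.
rewrite [leLHS]integral_mkcond le_eqVlt; apply/orP; left; apply/eqP.
apply: eq_integral => s _.
rewrite patchE; case: ifPn => [|].
  rewrite inE/= in_itv/= andbT => s0.
  by rewrite exponential_pdfE// /exponential_pdf mul1r -EFinM -expRD mulN1r.
rewrite notin_setE/= in_itv/= andbT => /negP; rewrite -ltNge => s0.
by rewrite lt0_exponential_pdf// mule0.
Qed.

End clip_integrals.

(** * The stationary renewal process *)

Section renewal_process.
Local Open Scope ereal_scope.
Context d (T : measurableType d) (R : realType) (P : probability T R).
Variables (xi : {RV P >-> R}) (tau : nat -> {RV P >-> R}).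
Hypothesis xi_ge0 : {ae P, forall w, (0 <= xi w)%R}.
Hypothesis xi_neq0 : P (xi @^-1` [set 0%R]) = 0.
Hypothesis tau_indep : mutually_independent P (fun n w => tau n w).
Hypothesis tau0_law : has_density P (tau 0%N) (residual_density xi).
Hypothesis tau_law : forall n, same_law P (tau n.+1) xi.

Let mu := @lebesgue_measure R.
Let K := renewal_step xi.

Definition mean_interval : R := fine 'E_P[xi].

(** A nonpositive value would make the residual density nonpositive, hence identically 0 (the
    inverse of 0 being 0), which contradicts its total mass 1. *)
Lemma mean_interval_gt0 : (0 < mean_interval)%R.
Proof.
rewrite ltNge; apply/negP => m0.
have [_ res0 resP] := tau0_law.
have p0 x : (0 <= fine (ccdf xi x))%R by rewrite fine_ge0.
have r0 x : residual_density xi x = 0%R.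
  apply/eqP; rewrite eq_le res0 andbT /residual_density; case: ifP => // _.
  by rewrite mulr_ge0_le0// invr_le0.
have := resP setT measurableT; rewrite preimage_setT probability_setT.
under eq_integral do rewrite r0.
by rewrite integral0 => /eqP; rewrite onee_eq0.
Qed.

(** The factor [mean_interval] stands on the left to avoid a division in \bar R. *)
Lemma first_epoch_law f : measurable_fun setT f -> (forall s, 0 <= f s) ->
  mean_interval%:E * \int[P]_w f (tau 0%N w) =
  \int[mu]_(s in `[0%R, +oo[) (f s * ccdf xi s).
Proof.
move=> mf f0; have [mres res0 resP] := tau0_law.
rewrite (ge0_integral_density (n := @lebesgue_measure R) (measurable_funPT (tau 0%N)) mres res0 resP)//.
have m0 := mean_interval_gt0.
rewrite -ge0_integralZl_EFin ?(ltW m0)//; last 2 first.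
- by move=> x _; rewrite mule_ge0// lee_fin.
- by apply: emeasurable_funM => //; exact/measurable_EFinP.
rewrite [RHS]integral_mkcond; apply: eq_integral => s _.
rewrite patchE muleCA -EFinM /residual_density mem_setE in_itv/= andbT.
case: ifP => _; last by rewrite mulr0 mule0.
rewrite -/mean_interval mulrC divfK ?gt_eqF// fineK//.
exact: fin_num_measure.
Qed.

Lemma integral_interval j (f : R -> \bar R) :
  measurable_fun setT f -> (forall s, 0 <= f s) ->
  \int[P]_w f (tau j.+1 w) = \int[P]_w f (xi w).
Proof. exact: (same_law_ge0_integral (tau_law j)). Qed.

Lemma ge0_integral_epoch_interval j (h : R -> R -> \bar R) :
  measurable_fun setT (fun z : R * R => h z.1 z.2) -> (forall x y, 0 <= h x y) ->
  \int[P]_w h (epoch tau j.+1 w) (tau j.+1 w) =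
  \int[P]_w \int[P]_v h (epoch tau j.+1 w) (xi v).
Proof.
move=> mh h0.
have mX : measurable_fun setT (epoch tau j.+1) by exact: measurable_epoch.
pose X : {RV P >-> R} := mfun_Sub (mem_set mX : _ \in mfun).
rewrite -[LHS]/(\int[P]_w h (X w) (tau j.+1 w)).
rewrite ge0_integral_indep//; last exact: epoch_indep.
apply: eq_integral => w _; rewrite integral_interval//.
exact: (measurableT_comp mh (measurable_pair1 (X w))).
Qed.

(** The last interval is independent of the epoch before it; integrating it out replaces [f] by
    [K f], so the induction runs over all [f]. The first interval has another law and remains as the
    starting point. *)
Lemma integral_epoch n f : measurable_fun setT f -> (forall s, 0 <= f s) ->
  \int[P]_w f (epoch tau n.+1 w) = \int[P]_w iter n K f (tau 0%N w).
Proof.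
elim: n f => [|n IH] f mf f0.
  by apply: eq_integral => w _; rewrite epochS epoch0 add0r.
rewrite iterSr -IH; last 2 first.
- exact: measurable_renewal_step.
- exact: renewal_step_ge0.
under eq_integral do rewrite epochS.
rewrite (@ge0_integral_epoch_interval n (fun x y => f (x + y)%R))//.
by apply: measurableT_comp => //; exact: measurable_funD.
Qed.

(** The Laplace transform of the law of [xi] at 1, i.e. the eigenvalue of [K] for s |-> exp(t -
    s). *)
Definition laplace_interval : R := fine (\int[P]_w (expR (- xi w))%:E).

Let mexp : measurable_fun setT (fun w => (expR (- xi w))%:E).
Proof. by apply/measurable_EFinP/measurableT_comp/measurableT_comp. Qed.

Let exp_le1 : \int[P]_w (expR (- xi w))%:E <= 1.
Proof.
rewrite -(@probability_setT _ _ _ P) -[leRHS]mul1e -integral_cst//.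
apply: ae_ge0_le_integral => //.
by apply: filterS xi_ge0 => w w0 _; rewrite lee_fin -expR0 ler_expR oppr_le0.
Qed.

Let laplace_fin : \int[P]_w (expR (- xi w))%:E \is a fin_num.
Proof.
rewrite ge0_fin_numE ?(le_lt_trans exp_le1) ?ltry//.
by apply: integral_ge0 => w _; rewrite lee_fin expR_ge0.
Qed.

Lemma laplace_interval_ge0 : (0 <= laplace_interval)%R.
Proof. by rewrite fine_ge0// integral_ge0// => w _; rewrite lee_fin expR_ge0. Qed.

Lemma laplace_interval_lt1 : (laplace_interval < 1)%R.
Proof.
rewrite -lte_fin /laplace_interval fineK// lt_neqAle exp_le1 andbT.
apply/negP => /eqP exp1.
pose g w : \bar R := (1 - expR (- xi w))%:E.
have mg : measurable_fun setT g.
  by apply/measurable_EFinP/measurable_funB/measurableT_comp/measurableT_comp.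
have Dg : \int[P]_w `|g w| + \int[P]_w (expR (- xi w))%:E = 1.
  rewrite -ge0_integralD//; last exact: measurableT_comp.
  rewrite -[RHS](@probability_setT _ _ _ P) -[RHS]mul1e -integral_cst//.
  apply: ge0_ae_eq_integral => //.
  - by apply: emeasurable_funD => //; exact: measurableT_comp.
  - by move=> w _; rewrite adde_ge0// lee_fin expR_ge0.
  - apply: filterS xi_ge0 => w w0 _; rewrite /g /= -EFinD ger0_norm ?subrK// subr_ge0.
    by rewrite -expR0 ler_expR oppr_le0.
have : \int[P]_w `|g w| = 0.
  by move: Dg; rewrite exp1 => /(congr1 (fun x => x - 1)); rewrite addeK// subee.
move=> /(ae_eq_integral_abs P measurableT mg).1[N [mN PN HN]].
(* If the mean of exp(- xi) were 1, then 1 - exp(- xi) would vanish off the null set [N]. So the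
   complement of [N] would lie inside the null event xi = 0, although it has probability 1. *)
have : P (~` N) = 0.
  apply/eqP; rewrite eq_le measure_ge0 andbT -[leRHS]xi_neq0.
  rewrite le_measure ?inE//; first exact: measurableC.
  move=> w /= Nw; apply/eqP; rewrite -oppr_eq0; apply/eqP.
  apply: (@expR_inj R); apply/eqP; rewrite expR0 eq_sym -subr_eq0; apply/eqP.
  apply: contrapT => gw; apply: Nw; apply: HN => /= /(_ I) [].
  exact: gw.
by rewrite probability_setC// PN sube0 => /eqP; rewrite onee_eq0.
Qed.

(** [K] is monotone, so a bound by a multiple of the eigenfunction gains one factor
    [laplace_interval] at each step. *)
Lemma iter_step_expR n (c t : R) (f : R -> \bar R) : (0 <= c)%R -> measurable_fun setT f ->
  (forall s, 0 <= f s) -> (forall s, f s <= (c * expR (t - s))%:E) ->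
  forall s, iter n K f s <= (c * laplace_interval ^+ n * expR (t - s))%:E.
Proof.
move=> c0 mf f0 fc; elim: n => [|n IH] s /=; first by rewrite expr0 mulr1.
have [mKn Kn0] := iter_renewal_step xi n mf f0.
apply: (@le_trans _ _ (\int[P]_w
    ((c * laplace_interval ^+ n * expR (t - s))%:E * (expR (- xi w))%:E))).
  apply: ge0_le_integral => //.
  - apply: measurableT_comp => //; exact: measurable_funD.
  - exact: emeasurable_funM.
  - move=> w _; apply: (le_trans (IH _)).
    by rewrite -EFinM lee_fin -[leRHS]mulrA -expRD opprD addrA.
rewrite ge0_integralZl_EFin//.
- by rewrite -[X in _ * X]fineK// -EFinM exprSr lee_fin -/laplace_interval le_eqVlt; apply/orP; left; apply/eqP; ring.
- by rewrite mulr_ge0 ?expR_ge0// mulr_ge0// exprn_ge0// laplace_interval_ge0.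
Qed.

Lemma sqr_clip_le (a x : R) : (clip a x ^+ 2 <= 2 * expR x)%R.
Proof.
have [x0|x0] := leP x 0%R.
  have -> : clip a x = 0%R.
    by rewrite /clip minEle; case: ifPn => ?; rewrite maxEle; case: ifPn => ?; lra.
  by rewrite expr0n mulr_ge0// expR_ge0.
have cx : (clip a x <= x)%R.
  by rewrite /clip minEle; case: ifPn => ?; rewrite maxEle; case: ifPn => ?; lra.
(* The Taylor bound 1 + x^2/2! <= exp x is the origin of the constant 2. *)
have := expR_ge1Dxn 1 (ltW x0).
have : (clip a x ^+ 2 <= x ^+ 2)%R by rewrite ler_sqr ?nnegrE ?clip_ge0// ltW.
rewrite (_ : 2`!%:R = 2 :> R)%R//; lra.
Qed.

(** The function f of the overview: the mean squared length before [t] of an interval distributed as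
    [xi] that starts at [s]. *)
Definition sqr_age (t s : R) : \bar R :=
  \int[P]_w (clip (xi w) (t - s) ^+ 2)%:E.

Lemma sqr_age_ge0 t s : 0 <= sqr_age t s.
Proof. by apply: integral_ge0 => w _; rewrite lee_fin sqr_ge0. Qed.

Lemma measurable_sqr_clip (t : R) :
  measurable_fun setT (fun z : R * R => (clip z.2 (t - z.1) ^+ 2)%:E : \bar R).
Proof.
apply/measurable_EFinP/measurable_funX.
apply: (measurableT_comp (@measurable_clip R) (g := fun z : R * R => (z.2, t - z.1)%R)).
by apply: measurable_fun_pair => //; exact: measurable_funB.
Qed.

Lemma measurable_sqr_age t : measurable_fun setT (sqr_age t).
Proof.
apply: (measurable_fun_integral_snd P
  (f := fun (s : R) (w : T) => (clip (xi w) (t - s) ^+ 2)%:E)).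
  apply: (measurableT_comp (measurable_sqr_clip t)
    (g := fun z : R * T => (z.1, xi z.2))).
  by apply: measurable_fun_pair => //; exact: measurableT_comp.
by move=> s w; rewrite lee_fin sqr_ge0.
Qed.

Lemma sqr_age_le t s : sqr_age t s <= (2 * expR (t - s))%:E.
Proof.
rewrite -[leRHS]mule1 -(@probability_setT _ _ _ P) -integral_cst//.
apply: ge0_le_integral => //.
- by move=> w _; rewrite lee_fin sqr_ge0.
- exact: (measurableT_comp (measurable_sqr_clip t) (measurableT_comp (measurable_pair1 s) (measurable_funPT xi))).
- by move=> w _; rewrite lee_fin sqr_clip_le.
Qed.

Definition sqr_gap (t : R) j : \bar R :=
  \int[P]_w (clip (tau j w) (t - epoch tau j w) ^+ 2)%:E.

Let J t n := \int[mu]_(s in `[0%R, +oo[) iter n K (sqr_age t) s.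

Let J_ge0 t n : 0 <= J t n.
Proof.
apply: integral_ge0 => s _.
by apply: (iter_renewal_step xi n (measurable_sqr_age t) (sqr_age_ge0 t)).2.
Qed.

Let J_le t n : J t n <= (2 * laplace_interval ^+ n * expR t)%:E.
Proof.
have [mKn Kn0] := iter_renewal_step xi n (measurable_sqr_age t) (sqr_age_ge0 t).
have c0 : (0 <= 2 * laplace_interval ^+ n)%R.
  by rewrite mulr_ge0// exprn_ge0// laplace_interval_ge0.
apply: (@le_trans _ _ (\int[mu]_(s in `[0%R, +oo[)
    ((2 * laplace_interval ^+ n)%:E * (expR (t - s))%:E))).
  apply: ge0_le_integral => //.
  - exact: measurable_funTS.
  - apply/measurable_funTS/emeasurable_funM => //.
    by apply/measurable_EFinP/measurableT_comp => //; exact: measurable_funB.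
  - move=> s _; rewrite -EFinM.
    apply: iter_step_expR => //; [exact: measurable_sqr_age|exact: sqr_age_ge0|exact: sqr_age_le].
rewrite ge0_integralZl_EFin//.
- by rewrite [leRHS]EFinM lee_wpmul2l// ?lee_fin// integral_expN.
- by apply/measurable_funTS/measurable_EFinP/measurableT_comp => //; exact: measurable_funB.
Qed.

(** Finiteness is what allows the remainder [J t n] to be cancelled in \bar R. *)
Let J_fin t n : J t n \is a fin_num.
Proof. by rewrite ge0_fin_numE// (le_lt_trans (J_le t n))// ltry. Qed.

Lemma sqr_gap_step t j : mean_interval%:E * sqr_gap t j.+1 + J t j.+1 = J t j.
Proof.
have [mKj Kj0] := iter_renewal_step xi j (measurable_sqr_age t) (sqr_age_ge0 t).
have -> : sqr_gap t j.+1 = \int[P]_w iter j K (sqr_age t) (tau 0%N w).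
  rewrite -integral_epoch; [|exact: measurable_sqr_age|exact: sqr_age_ge0].
  rewrite /sqr_gap (@ge0_integral_epoch_interval j
    (fun x y => (clip y (t - x) ^+ 2)%:E))//; first exact: measurable_sqr_clip.
  by move=> x y; rewrite lee_fin sqr_ge0.
by rewrite first_epoch_law// renewal_stationarity.
Qed.

Lemma sqr_gap_ge0 t j : 0 <= sqr_gap t j.
Proof. by apply: integral_ge0 => w _; rewrite lee_fin sqr_ge0. Qed.

Lemma sum_sqr_gap t n :
  mean_interval%:E * (\sum_(j < n) sqr_gap t j.+1) + J t n = J t 0.
Proof.
elim: n => [|n IH]; first by rewrite big_ord0 mule0 add0e.
rewrite big_ord_recr/= ge0_muleDr ?sqr_gap_ge0 ?sume_ge0//; last first.
  by move=> i _; exact: sqr_gap_ge0.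
by rewrite -addeA sqr_gap_step.
Qed.

(** Interval 0 starts at 0 and has the residual law, so it stays outside the telescoping sum and is
    integrated directly. *)
Lemma first_sqr_gap t : mean_interval%:E * sqr_gap t 0 =
  \int[mu]_(s in `[0%R, +oo[) ((clip s t ^+ 2)%:E * ccdf xi s).
Proof.
rewrite -first_epoch_law.
- congr (_ * _); apply: eq_integral => w _.
  by rewrite epoch0 subr0.
- by apply/measurable_EFinP/measurable_funX; exact: (measurableT_comp (@measurable_clip R) (measurable_pair2 t)).
- by move=> s; rewrite lee_fin sqr_ge0.
Qed.

(** After the layer cake formula, Tonelli is applied twice: exchanging with [P] turns the indicator
    of u < xi into P(xi > u), and exchanging with ds turns the indicator of u < t - s into the
    length (t - u)^+. *)
Lemma integral_sqr_age t : J t 0 =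
  \int[mu]_(u in `[0%R, +oo[)
    ((2 * `|u| * Num.max 0 (t - u))%:E * ccdf xi u).
Proof.
have mabs : measurable_fun setT (fun u : R => (2 * `|u|)%:E : \bar R).
  by apply/measurable_EFinP/measurable_funM.
have abs0 (u : R) : 0 <= (2 * `|u|)%:E :> \bar R by rewrite lee_fin mulr_ge0.
have mlt := @measurable_lt_indic R.
transitivity (\int[mu]_(s in `[0%R, +oo[) \int[mu]_(u in `[0%R, +oo[)
    ((2 * `|u|)%:E * (ccdf xi u * lt_indic u (t - s)%R))).
  apply: eq_integral => s _.
  rewrite /= /sqr_age.
  under eq_integral do rewrite sqr_clipE.
  rewrite (tonelli_in P (@lebesgue_measure R) (f := fun (w : T) (u : R) =>
    (2 * `|u|)%:E * (lt_indic u (xi w) * lt_indic u (t - s)%R)))//; last 2 first.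
  - apply: emeasurable_funM; first exact: measurableT_comp mabs _.
    apply: emeasurable_funM.
      apply: (measurableT_comp mlt (g := fun z : T * R => (z.2, xi z.1))).
      by apply: measurable_fun_pair => //; exact: measurableT_comp.
    apply: (measurableT_comp mlt (g := fun z : T * R => (z.2, t - s)%R)).
    exact: measurable_fun_pair.
  - by move=> w u; rewrite !mule_ge0// lt_indic_ge0.
  apply: eq_integral => u _.
  have mltu : measurable_fun setT (fun w => lt_indic u (xi w)).
    apply: (measurableT_comp mlt (g := fun w => (u, xi w))).
    exact: measurable_fun_pair.
  rewrite ge0_integralZl//; last 2 first.
  - exact: emeasurable_funM.
  - by move=> w _; rewrite mule_ge0// lt_indic_ge0.
  rewrite ge0_integralZr ?lt_indic_ge0//; last by move=> w _; exact: lt_indic_ge0.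
  congr (_ * (_ * _)).
  transitivity (\int[P]_w (\1_(xi @^-1` `]u, +oo[) w)%:E).
    apply: eq_integral => w _; rewrite lt_indicE indicE.
    congr ((nat_of_bool _)%:R%:E).
    by apply/idP/idP; rewrite inE/= in_itv/= andbT.
  rewrite integral_indic ?setIT//.
  by rewrite -[X in measurable X]setTI; exact: measurable_funPT.
rewrite (tonelli_in (@lebesgue_measure R) (@lebesgue_measure R)
  (f := fun (s u : R) => (2 * `|u|)%:E * (ccdf xi u * lt_indic u (t - s)%R)))//; last 2 first.
- apply: emeasurable_funM; first exact: measurableT_comp mabs _.
  apply: emeasurable_funM; first exact: measurableT_comp (ccdf_measurable xi) _.
  apply: (measurableT_comp mlt (g := fun z : R * R => (z.2, t - z.1)%R)).
  by apply: measurable_fun_pair => //; exact: measurable_funB.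
- by move=> s u; rewrite !mule_ge0// lt_indic_ge0.
apply: eq_integral => u _.
have mltu : measurable_fun setT (fun s : R => lt_indic u (t - s)%R).
  apply: (measurableT_comp mlt (g := fun s : R => (u, t - s)%R)).
  by apply: measurable_fun_pair => //; exact: measurable_funB.
rewrite ge0_integralZl//; last 2 first.
- by apply/measurable_funTS/emeasurable_funM.
- by move=> s _; rewrite mule_ge0// lt_indic_ge0.
rewrite ge0_integralZl//; last 2 first.
- exact: measurable_funTS.
- by move=> s _; exact: lt_indic_ge0.
by rewrite integral_lt_indic [in RHS]EFinM -muleA; congr (_ * _); rewrite muleC.
Qed.

Lemma sum_sqr_gap_cvg t (B : R) :
  mean_interval%:E * sqr_gap t 0 + J t 0 = B%:E ->
  \sum_(j < n) sqr_gap t j @[n --> \oo] --> (B / mean_interval)%:E.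
Proof.
move=> BE; have m0 := mean_interval_gt0.
have J_cvg : J t n @[n --> \oo] --> 0.
  apply: (@squeeze_cvge _ _ _ _ (cst 0) _
    (fun n => (2 * laplace_interval ^+ n * expR t)%:E)).
  - by apply: nearW => n; rewrite J_ge0 J_le.
  - exact: cvg_cst.
  - apply: cvg_EFin; first exact: nearW.
    rewrite (_ : 0%R = 2 * 0 * expR t)%R; last by rewrite mulr0 mul0r.
    apply: cvgM; last exact: cvg_cst.
    apply: cvgM; first exact: cvg_cst.
    apply: cvg_expr.
    by rewrite ger0_norm ?laplace_interval_ge0// laplace_interval_lt1.
have H : (mean_interval^-1)%:E * (B%:E - J t n) @[n --> \oo] -->
    (B / mean_interval)%:E.
  rewrite (_ : (B / mean_interval)%:E = (mean_interval^-1)%:E * (B%:E - 0)); last first.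
    by rewrite sube0 -EFinM mulrC.
  by apply: cvgeZl => //; apply: cvgeB => //; exact: cvg_cst.
(* The telescoping identity covers the intervals 1 to n, so the sum is shifted by one: n + 1 terms
   are interval 0 plus n telescoped ones. *)
rewrite -cvg_shiftS; apply: cvg_trans H; apply: near_eq_cvg; apply: nearW => n.
rewrite -BE -(sum_sqr_gap t n) addeA addeK//.
rewrite /= big_ord_recl/= -ge0_muleDr ?sqr_gap_ge0 ?sume_ge0//; last first.
  by move=> i _; exact: sqr_gap_ge0.
by rewrite muleA -EFinM mulVf ?mul1e ?gt_eqF.
Qed.

Lemma ae_interval_ge0 j : {ae P, forall w, (0 <= tau j w)%R}.
Proof.
have mN : measurable (`]-oo, 0%R[%classic : set R) by exact: measurable_itv.
have : P (tau j @^-1` `]-oo, 0%R[%classic) = 0; last first.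
  move=> PN; exists (tau j @^-1` `]-oo, 0%R[%classic); split => //.
    by rewrite -[X in measurable X]setTI; exact: measurable_funPT.
  by move=> w /= /negP; rewrite in_itv/= ltNge.
case: j => [|j].
  have [_ _ ->//] := tau0_law.
  rewrite integral0_eq// => x /=; rewrite in_itv/= => x0.
  by rewrite /residual_density leNgt x0.
rewrite (tau_law j)//; case: xi_ge0 => N [mN' PN HN].
apply/eqP; rewrite eq_le measure_ge0 andbT -[leRHS]PN le_measure ?inE//.
  by rewrite -[X in measurable X]setTI; exact: measurable_funPT.
move=> w /=; rewrite in_itv/= => w0; apply: HN => /=.
by apply/negP; rewrite -ltNge.
Qed.

(** Chernoff bound: the indicator of epoch <= t is at most exp(t - epoch), whose expectation decays
    geometrically with the number of intervals. *)
Lemma ae_epoch_gt t : {ae P, forall w, exists n, (t < epoch tau n w)%R}.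
Proof.
pose N := \bigcap_n (epoch tau n @^-1` `]-oo, t]%classic).
have mE n : measurable (epoch tau n @^-1` `]-oo, t]%classic).
  by rewrite -[X in measurable X]setTI; exact: measurable_epoch.
have mN : measurable N by exact: bigcapT_measurable.
exists N; split => //; last first.
  move=> w /= /forallNP Hw n _ /=; rewrite in_itv/= leNgt; apply/negP.
  exact: Hw.
have m0 := mean_interval_gt0.
pose f (s : R) : \bar R := (expR (t - s))%:E.
have mf : measurable_fun setT f.
  by apply/measurable_EFinP/measurableT_comp => //; exact: measurable_funB.
have f0 s : 0 <= f s by rewrite lee_fin expR_ge0.
have Pn n : P N <= (laplace_interval ^+ n)%:E * \int[P]_w f (tau 0%N w).
  apply: (@le_trans _ _ (P (epoch tau n.+1 @^-1` `]-oo, t]%classic))).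
    by rewrite le_measure ?inE//; exact: bigcap_inf.
  rewrite -[X in P X <= _]setIT -integral_indic//.
  apply: (@le_trans _ _ (\int[P]_w f (epoch tau n.+1 w))).
    apply: ge0_le_integral => //.
    - exact/measurable_EFinP/measurable_indic.
    - by apply: measurableT_comp => //; exact: measurable_epoch.
    - move=> w _; rewrite indicE /f lee_fin; case: (boolP (_ \in _)) => [|_].
        rewrite inE/= in_itv/= => wt.
        by rewrite -[leLHS]expR0 ler_expR subr_ge0.
      exact: expR_ge0.
  rewrite integral_epoch// -ge0_integralZl_EFin//; last 2 first.
  - exact: measurableT_comp.
  - by rewrite exprn_ge0// laplace_interval_ge0.
  have [mKn Kn0] := iter_renewal_step xi n mf f0.
  apply: ge0_le_integral => //.
  - exact: measurableT_comp.
  - by apply: emeasurable_funM => //; exact: measurableT_comp.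
  - move=> w _; rewrite -EFinM -[(laplace_interval ^+ n)%R]mul1r.
    by apply: iter_step_expR => // s; rewrite mul1r.
have Ble : mean_interval%:E * \int[P]_w f (tau 0%N w) <= (expR t)%:E.
  rewrite first_epoch_law//; apply: le_trans (integral_expN t).
  apply: ge0_le_integral => //.
  - by move=> s _; rewrite mule_ge0.
  - by apply/measurable_funTS/emeasurable_funM => //; exact: ccdf_measurable.
  - exact: measurable_funTS.
  - by move=> s _; rewrite -[leRHS]mule1 lee_wpmul2l// probability_le1.
have PN_fin : P N \is a fin_num by exact: fin_num_measure.
apply/eqP; rewrite eq_le measure_ge0 andbT -(fineK PN_fin) lee_fin.
(* The bound [Ble] on E exp(t - tau_0) carries the mean as a factor, so the mean is also put in
   front of [P N]. *)
rewrite -(pmulr_rle0 _ m0).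
have : (laplace_interval ^+ n * expR t)%R @[n --> \oo] --> (0 * expR t)%R.
  apply: cvgM; last exact: cvg_cst.
  apply: cvg_expr.
  by rewrite ger0_norm ?laplace_interval_ge0// laplace_interval_lt1.
rewrite mul0r => /cvgr_to_ge; apply.
apply: nearW => n; rewrite -lee_fin [leLHS]EFinM (fineK PN_fin).
apply: (@le_trans _ _ (mean_interval%:E *
    ((laplace_interval ^+ n)%:E * \int[P]_w f (tau 0%N w)))).
  by rewrite lee_wpmul2l// lee_fin ltW.
by rewrite muleCA [leRHS]EFinM lee_wpmul2l// lee_fin exprn_ge0// laplace_interval_ge0.
Qed.

End renewal_process.

(** * The closed form of the sum of the squared lengths *)

Section tail_integrals.
Local Open Scope ereal_scope.
Context d (T : measurableType d) (R : realType) (P : probability T R).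
Variable xi : {RV P >-> R}.
Let mu := @lebesgue_measure R.
Hypothesis tail_fin : \int[mu]_(s in `[0%R, +oo[) ccdf xi s < +oo.

(** The bracket of the theorem; 2 / E xi times it is the sum of all E l_j^2. *)
Definition residual_variance (t : R) : R :=
  (\int[lebesgue_measure]_(u in `[0, t])
      ((t * u - 2^-1 * u ^+ 2) * fine (ccdf xi u)) +
   2^-1 * t ^+ 2 *
   \int[lebesgue_measure]_(u in `[t, +oo[) fine (ccdf xi u))%R.

(** The domain is split at [t] and the integrands are compared pointwise. [in1] and [in2] are needed
    because the real-valued integrals are [fine] of extended ones; in [in1] the polynomial is
    bounded by t^2. *)
Lemma residual_varianceE t : (0 <= t)%R ->
  \int[mu]_(s in `[0%R, +oo[) ((clip s t ^+ 2)%:E * ccdf xi s) +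
  \int[mu]_(u in `[0%R, +oo[) ((2 * `|u| * Num.max 0 (t - u))%:E * ccdf xi u) =
  (2 * residual_variance t)%:E.
Proof.
move=> t0; pose p u := fine (ccdf xi u).
have pE u : ccdf xi u = (p u)%:E by rewrite /p fineK// fin_num_measure.
have p0 u : (0 <= p u)%R by rewrite fine_ge0.
have pE0 u : 0 <= (p u)%:E by rewrite lee_fin.
have mp : measurable_fun setT p.
  apply/measurable_EFinP; apply: (eq_measurable_fun (ccdf xi)).
    by move=> u _; rewrite pE.
  exact: ccdf_measurable.
have mcl : measurable_fun setT (fun s : R => clip s t).
  exact: (measurableT_comp (@measurable_clip R) (measurable_pair2 t)).
have mh2 : measurable_fun setT (fun u : R => 2 * `|u| * Num.max 0 (t - u))%R.
  apply: measurable_funM; first exact: measurable_funM.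
  by apply: measurable_maxr => //; exact: measurable_funB.
have h0 u : (0 <= 2 * `|u| * Num.max 0 (t - u))%R.
  by rewrite mulr_ge0 ?mulr_ge0// le_max lexx.
have mccdf := ccdf_measurable xi.
rewrite -ge0_integralD//; last 4 first.
- by move=> s _; rewrite mule_ge0// lee_fin sqr_ge0.
- by apply/measurable_funTS/emeasurable_funM => //; exact/measurable_EFinP/measurable_funX.
- by move=> s _; rewrite mule_ge0// lee_fin.
- by apply/measurable_funTS/emeasurable_funM => //; exact/measurable_EFinP.
have poly0 u : u \in `[0%R, t]%classic -> (0 <= t * u - 2^-1 * u ^+ 2)%R.
  by rewrite inE/= in_itv/= => /andP[u0 ut]; nra.
have mpoly : measurable_fun setT (fun u : R => (t * u - 2^-1 * u ^+ 2) * p u)%R.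
  apply: measurable_funM => //; apply: measurable_funB; first exact: measurable_funM.
  by apply: measurable_funM => //; exact: exprn_measurable.
have Dsub (A : set R) : A `<=` `[0%R, +oo[%classic -> measurable A ->
    \int[mu]_(u in A) (p u)%:E < +oo.
  move=> AD mA; apply: le_lt_trans tail_fin.
  under [leRHS]eq_integral do rewrite pE.
  apply: ge0_subset_integral => //.
  exact/measurable_funTS/measurable_EFinP.
have in1 : \int[mu]_(u in `[0%R, t]) ((t * u - 2^-1 * u ^+ 2) * p u)%:E \is a fin_num.
  rewrite ge0_fin_numE; last first.
    by apply: integral_ge0 => u u0; rewrite lee_fin mulr_ge0// poly0// inE.
  apply: (@le_lt_trans _ _ ((t ^+ 2)%:E * \int[mu]_(u in `[0%R, t]) (p u)%:E)).
    rewrite -ge0_integralZl_EFin ?sqr_ge0//; last exact/measurable_funTS/measurable_EFinP.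
    apply: ge0_le_integral => //.
    - by move=> u u0; rewrite lee_fin mulr_ge0// poly0// inE.
    - exact/measurable_funTS/measurable_EFinP.
    - apply/measurable_funTS/emeasurable_funM => //; exact/measurable_EFinP.
    - move=> u /=; rewrite in_itv/= => /andP[u0 ut].
      by rewrite -EFinM lee_fin ler_wpM2r//; nra.
  rewrite lte_mul_pinfty ?lee_fin ?sqr_ge0//; apply: Dsub => // u /=.
  by rewrite !in_itv/= andbT => /andP[].
have in2 : \int[mu]_(u in `[t, +oo[) (p u)%:E \is a fin_num.
  rewrite ge0_fin_numE; last by apply: integral_ge0 => u _; rewrite lee_fin.
  apply: Dsub => // u /=; rewrite !in_itv/= !andbT; exact: le_trans.
transitivity (\int[mu]_(u in `[0%R, +oo[)
  (((clip u t ^+ 2 + 2 * `|u| * Num.max 0 (t - u)) * p u)%:E)).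
  by apply: eq_integral => u _; rewrite pE -!EFinM -EFinD -mulrDl.
have mfull : measurable_fun setT (fun u : R =>
    ((clip u t ^+ 2 + 2 * `|u| * Num.max 0 (t - u)) * p u)%R).
  by apply: measurable_funM => //; apply: measurable_funD => //; exact: measurable_funX.
rewrite (_ : `[0%R, +oo[%classic = `[0%R, t]%classic `|` `]t, +oo[%classic); last first.
  apply/seteqP; split=> u /=; rewrite !in_itv/= !andbT.
    by move=> ->; have [_|_] := leP u t; [left|right].
  by move=> [/andP[]//|tu]; exact: (le_trans t0 (ltW tu)).
rewrite ge0_integral_setU//; last 3 first.
- exact/measurable_funTS/measurable_EFinP.
- by move=> u _; rewrite lee_fin mulr_ge0// addr_ge0// sqr_ge0.
- apply/disj_setPS => u [] /=; rewrite !in_itv/= andbT => /andP[_ ut].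
  by rewrite ltNge ut.
rewrite /residual_variance mulrDr EFinD; congr (_ + _).
  rewrite EFinM fineK// -ge0_integralZl_EFin//; last 2 first.
  - by move=> u u0; rewrite lee_fin mulr_ge0 ?p0// poly0// inE.
  - exact/measurable_funTS/measurable_EFinP.
  apply: eq_integral => u; rewrite inE/= in_itv/= => /andP[u0 ut].
  rewrite -EFinM mulrA; congr ((_ * _)%:E).
  rewrite ger0_norm// /clip min_l// max_r// max_r ?subr_ge0//.
  by field.
rewrite mulrA (mulrA 2%R) divff ?mul1r; last by rewrite pnatr_eq0.
rewrite EFinM fineK// -[X in _ = _ * X]integral_itv_obnd_cbnd; last first.
  exact/measurable_funTS/measurable_EFinP.
rewrite -ge0_integralZl_EFin ?sqr_ge0//; last 2 first.
- by move=> u _; exact: pE0.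
- exact/measurable_funTS/measurable_EFinP.
apply: eq_integral => u; rewrite inE/= in_itv/= andbT => tu.
rewrite -EFinM; congr ((_ * _)%:E).
by rewrite /clip min_r ?(ltW tu)// max_r// max_l ?mulr0 ?addr0// subr_le0 ltW.
Qed.

End tail_integrals.

(** * Second moments *)

Section second_moments.
Local Open Scope ereal_scope.
Context d (T : measurableType d) (R : realType) (P : probability T R).

Lemma Lfun2_sqr_lty (f : T -> R) : measurable_fun setT f ->
  \int[P]_w (f w ^+ 2)%:E < +oo -> f \in Lfun P 2%:E.
Proof.
move=> mf fin; rewrite inE; apply/andP; split; rewrite inE//=.
rewrite /finite_norm unlock /Lnorm poweR_lty//.
rewrite (eq_integral (fun w => (f w ^+ 2)%:E))// => w _.
by rewrite /= powR_mulrn// real_normK ?num_real.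
Qed.

(** The positive part agrees almost surely with [L] and is nonnegative everywhere, as later Tonelli
    arguments require. *)
Lemma variance_nonneg (L : {RV P >-> R}) :
  {ae P, forall w, (0 <= L w)%R} -> 'V_P[L] < +oo ->
  [/\ (0 <= fine 'E_P[L])%R,
      \int[P]_w (Num.max 0%R (L w))%:E = (fine 'E_P[L])%:E &
      \int[P]_w (Num.max 0%R (L w) ^+ 2)%:E =
        (fine 'V_P[L] + fine 'E_P[L] ^+ 2)%:E].
Proof.
move=> L0 Lv.
have mL : measurable_fun setT (L : T -> R) by exact: measurable_funPT.
have mmax : measurable_fun setT (fun w => Num.max 0%R (L w)) by exact: measurable_maxr.
set c := fine 'E_P[L].
(* Finite variance says that [L - c] is square integrable, with [c] real by the use of [fine];
   adding the constant back gives [L], and only then is the mean known to be finite. *)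
have L2 : (L : T -> R) \in Lfun P 2%:E.
  rewrite (_ : (L : T -> R) = (L \- cst c) \+ cst c)%R; last first.
    by apply/funext => w /=; rewrite subrK.
  apply: rpredD => [|?|?]; [by rewrite lee1n| |exact: Lfun_cst].
  apply: Lfun2_sqr_lty; first exact: measurable_funB.
  apply: le_lt_trans Lv; rewrite /variance covariance.unlock expectation.unlock.
  rewrite le_eqVlt; apply/orP; left; apply/eqP; apply: eq_integral => w _.
  by rewrite /c expectation.unlock.
have L1 : (L : T -> R) \in Lfun P 1 by exact: (Lfun_subset12 (fin_num_measure P _ measurableT) L2).
have E1 : \int[P]_w (Num.max 0%R (L w))%:E = 'E_P[L].
  rewrite expectation.unlock; apply: ae_eq_integral => //; try exact/measurable_EFinP.
  by apply: filterS L0 => w w0 _ /=; rewrite max_r.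
have E2 : \int[P]_w (Num.max 0%R (L w) ^+ 2)%:E = 'E_P[(L : T -> R) ^+ 2].
  rewrite expectation.unlock; apply: ae_eq_integral => //.
  - exact/measurable_EFinP/measurable_funX.
  - by apply/measurable_EFinP; exact: (measurable_funM mL mL).
  by apply: filterS L0 => w w0 _ /=; rewrite max_r.
have EL_fin : 'E_P[L] \is a fin_num by exact: expectation_fin_num.
have cE : 'E_P[L] = c%:E by rewrite /c fineK.
split.
- by rewrite fine_ge0// -E1 integral_ge0// => w _; rewrite lee_fin le_max lexx.
- by rewrite E1.
- rewrite E2 EFinD fineK ?variance_fin_num// varianceE// cE -EFin_expe subeK//.
Qed.

Lemma cvg_integral_eventually (Y : nat -> T -> R) (Z : T -> R) :
  (forall n, measurable_fun setT (Y n)) -> measurable_fun setT Z ->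
  (forall n w, 0 <= Y n w)%R -> (forall w, 0 <= Z w)%R ->
  (forall w, {homo Y ^~ w : m n / (m <= n)%N >-> (m <= n)%R}) ->
  {ae P, forall w, exists n0, forall n, (n0 <= n)%N -> Y n w = Z w} ->
  \int[P]_w (Y n w)%:E @[n --> \oo] --> \int[P]_w (Z w)%:E.
Proof.
move=> mY mZ Y0 Z0 ndY YZ.
have mYE n : measurable_fun setT (EFin \o Y n) by exact/measurable_EFinP.
have ndYE w : nondecreasing_seq (fun n => (Y n w)%:E).
  by move=> m n mn; rewrite lee_fin ndY.
have -> : \int[P]_w (Z w)%:E = \int[P]_w limn (fun n => (Y n w)%:E).
  apply: ae_eq_integral => //; first exact/measurable_EFinP.
    apply: (emeasurable_fun_cvg (fun n => EFin \o Y n)) => // w _.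
    exact: (ereal_nondecreasing_is_cvgn (ndYE w)).
  apply: filterS YZ => w [n0 Hn0] _; apply/esym/cvg_lim => //.
  apply: cvg_near_cst; exists n0 => // n /= n0n.
  by rewrite Hn0.
by apply: cvg_monotone_convergence => // n w _; rewrite lee_fin.
Qed.

Lemma ge0_integral_indepM (X Y : {RV P >-> R}) :
  (forall w, 0 <= X w)%R -> (forall w, 0 <= Y w)%R ->
  (forall A B, measurable A -> measurable B ->
     P (X @^-1` A `&` Y @^-1` B) = P (X @^-1` A) * P (Y @^-1` B)) ->
  \int[P]_w (X w * Y w)%:E = \int[P]_w (X w)%:E * \int[P]_w (Y w)%:E.
Proof.
move=> X0 Y0 XY.
have mX : measurable_fun setT (fun w => (X w)%:E) by exact/measurable_EFinP.
have mY : measurable_fun setT (fun w => (Y w)%:E) by exact/measurable_EFinP.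
(* [ge0_integral_indep] wants a kernel that is nonnegative on the whole plane, not only on the
   values of [X] and [Y]. *)
transitivity (\int[P]_w (`|X w|%:E * `|Y w|%:E)).
  by apply: eq_integral => w _; rewrite !ger0_norm.
rewrite (ge0_integral_indep (h := fun x y : R => `|x|%:E * `|y|%:E))//; last first.
  by apply: emeasurable_funM; apply/measurable_EFinP/measurableT_comp.
under eq_integral.
  move=> w _; rewrite ge0_integralZl_EFin//; last exact/measurable_EFinP/measurableT_comp.
  over.
rewrite ge0_integralZr//; last 2 first.
- exact/measurable_EFinP/measurableT_comp.
- exact: integral_ge0.
by congr (_ * _); apply: eq_integral => w _; rewrite ger0_norm.
Qed.

End second_moments.

(** * Functions measurable for a generated sigma-algebra *)

Section generated_sigma_algebra.
Context (I : Type) d (T : measurableType d) d' (U : measurableType d').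

Let systems (X : I -> T -> U) :=
  \bigcup_(i in [set: I]) preimage_set_system setT (X i) measurable.

Lemma measurable_fun_generated (X : I -> T -> U) i :
  @measurable_fun _ _ (g_sigma_algebraType (systems X)) U setT (X i).
Proof.
move=> _ B mB; rewrite setTI; apply: sub_sigma_algebra.
by exists i => //; exists B => //; rewrite setTI.
Qed.

(** [T] is equipped anew with the sigma-algebra generated by [X], so that membership in [sigma_of]
    follows from the usual closure properties of measurable functions. *)
Lemma sigma_of_preimage (X : I -> T -> U) d2 (V : measurableType d2)
    (F : T -> V) (B : set V) :
  @measurable_fun _ _ (g_sigma_algebraType (systems X)) V setT F ->
  measurable B -> sigma_of setT X (F @^-1` B).
Proof. by move=> mF mB; have := mF measurableT B mB; rewrite setTI. Qed.

Lemma sigma_of_measurable (D : set I) (X : I -> T -> U) :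
  (forall i, D i -> measurable_fun setT (X i)) ->
  sigma_of D X `<=` measurable.
Proof.
move=> mX; apply: smallest_sub; first exact: sigma_algebra_measurable.
move=> A [i Di [B mB <-]]; exact: mX.
Qed.

End generated_sigma_algebra.

(** * Variance of the cumulative count *)

Section cumulative_count.
Local Open Scope ereal_scope.
Context d (T : measurableType d) (R : realType) (P : probability T R).
Variables (xi L : {RV P >-> R}) (tau Ls : nat -> {RV P >-> R}).
Hypothesis xi_ge0 : {ae P, forall w, (0 <= xi w)%R}.
Hypothesis xi_neq0 : P (xi @^-1` [set 0%R]) = 0.
Hypothesis tau_indep : mutually_independent P (fun n w => tau n w).
Hypothesis tau0_law : has_density P (tau 0%N) (residual_density xi).
Hypothesis tau_law : forall n, same_law P (tau n.+1) xi.
Hypothesis L_ge0 : {ae P, forall w, (0 <= L w)%R}.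
Hypothesis L_var : 'V_P[L] < +oo.
Hypothesis Ls_law : forall n, same_law P (Ls n) L.
Hypothesis Ls_indep : forall i j, i != j ->
  forall A B, measurable A -> measurable B ->
  P (Ls i @^-1` A `&` Ls j @^-1` B) = P (Ls i @^-1` A) * P (Ls j @^-1` B).
Hypothesis tau_Ls_indep : independent_systems P
  (sigma_of setT (fun n w => tau n w)) (sigma_of setT (fun n w => Ls n w)).
Variable t : R.
Hypothesis t_ge0 : (0 <= t)%R.

Let c := fine 'E_P[L].
Let v := fine 'V_P[L].
Let m := mean_interval xi.

Let gap j w := clip (tau j w) (t - epoch tau j w).
Let rate j w := Num.max 0%R (Ls j w).
Let X n w := (\sum_(j < n) rate j w * gap j w)%R.
Let S n w := (\sum_(j < n) gap j w)%R.

Let gap_ge0 j w : (0 <= gap j w)%R. Proof. exact: clip_ge0. Qed.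

Let rate_ge0 j w : (0 <= rate j w)%R. Proof. by rewrite /rate le_max lexx. Qed.

Let X_ge0 n w : (0 <= X n w)%R.
Proof. by apply: sumr_ge0 => j _; rewrite mulr_ge0. Qed.

Let S_ge0 n w : (0 <= S n w)%R.
Proof. by apply: sumr_ge0 => j _. Qed.

(** The domain is left general because the lemma is used for [T] itself and for [T] with the
    sigma-algebra generated by the intervals. *)
Let measurable_gap_gen d0 (T0 : measurableType d0) (tau' : nat -> T0 -> R) j :
  (forall i, measurable_fun setT (tau' i)) ->
  measurable_fun setT (fun w => clip (tau' j w) (t - epoch tau' j w)).
Proof.
move=> mtau.
apply: (measurableT_comp (@measurable_clip R)
  (g := fun w => (tau' j w, t - epoch tau' j w)%R)).
apply: measurable_fun_pair => //; apply: measurable_funB => //.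
exact: measurable_sum.
Qed.

Let mgap j : measurable_fun setT (gap j).
Proof. by apply: measurable_gap_gen => i; exact: measurable_funPT. Qed.

Let mrate j : measurable_fun setT (rate j).
Proof. by apply: measurable_maxr => //; exact: measurable_funPT. Qed.

Let mX n : measurable_fun setT (X n).
Proof. by apply: measurable_sum => j; exact: measurable_funM. Qed.

Let mS n : measurable_fun setT (S n).
Proof. exact: measurable_sum. Qed.

Let ae_Ls_ge0 j : {ae P, forall w, (0 <= Ls j w)%R}.
Proof.
have mN : measurable (`]-oo, 0%R[%classic : set R) by exact: measurable_itv.
exists (Ls j @^-1` `]-oo, 0%R[%classic); split.
- by rewrite -[X in measurable X]setTI; exact: measurable_funPT.
- rewrite Ls_law//; case: L_ge0 => N [mN' PN HN].
  apply/eqP; rewrite eq_le measure_ge0 andbT -[leRHS]PN le_measure ?inE//.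
    by rewrite -[X in measurable X]setTI; exact: measurable_funPT.
  move=> w /=; rewrite in_itv/= => w0; apply: HN => /=.
  by apply/negP; rewrite -ltNge.
- by move=> w /= /negP; rewrite in_itv/= ltNge.
Qed.

Let ae_good : {ae P, forall w, [/\ forall i, (0 <= tau i w)%R,
  exists n, (t < epoch tau n w)%R & forall i, (0 <= Ls i w)%R]}.
Proof.
have H1 := ae_foralln (ae_interval_ge0 xi_ge0 tau0_law tau_law).
have H2 := ae_epoch_gt xi_ge0 xi_neq0 tau_indep tau0_law tau_law t.
have H3 := ae_foralln ae_Ls_ge0.
by apply: filterS3 H1 H2 H3 => w.
Qed.

Let X_eventually w : (forall i, (0 <= tau i w)%R) ->
  (forall i, (0 <= Ls i w)%R) -> (exists n, (t < epoch tau n w)%R) ->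
  exists n0, forall n, (n0 <= n)%N -> X n w =
    (\int[lebesgue_measure]_(s in `[0, t]) resampled tau Ls s w)%R.
Proof.
move=> tau0 Ls0 [n0 Hn0]; exists n0 => n n0n.
have tn := lt_le_trans Hn0 (nondecreasing_epoch tau0 n0n).
rewrite /Rintegral (integral_resampled tau0 Ls0 t_ge0 tn)/=.
by apply: eq_bigr => j _; rewrite /rate max_r.
Qed.

Let S_eventually w : (forall i, (0 <= tau i w)%R) ->
  (exists n, (t < epoch tau n w)%R) ->
  exists n0, forall n, (n0 <= n)%N -> S n w = t.
Proof.
move=> tau0 [n0 Hn0]; exists n0 => n n0n.
have tn := lt_le_trans Hn0 (nondecreasing_epoch tau0 n0n).
(* With all rates equal to 1 the integral over [0, t] is t, and the sum is that of the lengths. *)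
have := integral_resampled (L := fun _ _ => 1%R) tau0 (fun=> ler01) t_ge0 tn.
under eq_bigr do rewrite mul1r.
move=> H; apply: EFin_inj; rewrite -[LHS]H.
transitivity (\int[lebesgue_measure]_(s in `[0%R, t]) (cst 1 s : \bar R)).
  exact: eq_integral.
rewrite integral_cst//= mul1e lebesgue_measure_itv/= lte_fin.
case: ltP => [_|t0]; first by rewrite sube0.
by congr (_%:E); apply/eqP; rewrite eq_le t_ge0 t0.
Qed.

Let nondecreasing_X w k : {homo (fun n => X n w ^+ k)%R : a b / (a <= b)%N >-> (a <= b)%R}.
Proof.
apply: homo_leq => [//|? ? ?|n]; first exact: le_trans.
rewrite lerXn2r ?nnegrE//.
by rewrite /X big_ord_recr/= lerDl mulr_ge0.
Qed.

Let nondecreasing_S w k : {homo (fun n => S n w ^+ k)%R : a b / (a <= b)%N >-> (a <= b)%R}.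
Proof.
apply: homo_leq => [//|? ? ?|n]; first exact: le_trans.
rewrite lerXn2r ?nnegrE//.
by rewrite /S big_ord_recr/= lerDl.
Qed.

Let cvg_S k : \int[P]_w (S n w ^+ k)%:E @[n --> \oo] --> (t ^+ k)%:E.
Proof.
have -> : (t ^+ k)%:E = \int[P]_w (cst (t ^+ k)%R w)%:E.
  rewrite -[RHS]/(\int[P]_w cst (t ^+ k)%:E w) integral_cst//.
  by rewrite /= probability_setT mule1.
apply: (@cvg_integral_eventually _ _ _ P (fun n w => S n w ^+ k)%R) => //.
- by move=> n; exact: measurable_funX.
- by move=> n w; rewrite exprn_ge0.
- by move=> w; rewrite exprn_ge0.
- apply: filterS ae_good => w [tau0 ex _].
  have [n0 Hn0] := S_eventually tau0 ex.
  by exists n0 => n n0n; rewrite Hn0.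
Qed.

Let integral_rate j : \int[P]_w (rate j w)%:E = c%:E.
Proof.
have [_ <- _] := variance_nonneg L_ge0 L_var.
apply: (same_law_ge0_integral (Ls_law j) (f := fun x : R => (Num.max 0%R x)%:E)).
  by apply/measurable_EFinP; exact: measurable_maxr.
by move=> x; rewrite lee_fin le_max lexx.
Qed.

Let integral_rate2 i j :
  \int[P]_w (rate i w * rate j w)%:E = (c ^+ 2 + (i == j)%:R * v)%:E.
Proof.
have [<-|ij] := eqVneq i j; last first.
  rewrite mul0r addr0 expr2 EFinM -{1}(integral_rate i) -(integral_rate j).
  have mm : measurable_fun setT (fun x : R => (Num.max 0%R x)%:E : \bar R).
    by apply/measurable_EFinP; exact: measurable_maxr.
  have max0 (x : R) : 0 <= (Num.max 0%R x)%:E by rewrite lee_fin le_max lexx.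
  under eq_integral do rewrite EFinM.
  rewrite (ge0_integral_indep (h := fun x y : R => (Num.max 0%R x)%:E * (Num.max 0%R y)%:E)).
  - under eq_integral.
      move=> w _; rewrite ge0_integralZl_EFin ?le_max ?lexx//; last exact: (measurableT_comp mm).
      over.
    rewrite ge0_integralZr//.
    + exact: (measurableT_comp mm).
    + by apply: integral_ge0 => w _; exact: max0.
  - exact: Ls_indep.
  - by apply: emeasurable_funM; exact: (measurableT_comp mm).
  - by move=> x y; rewrite mule_ge0.
rewrite mul1r addrC.
have [_ _ <-] := variance_nonneg L_ge0 L_var.
rewrite -(same_law_ge0_integral (Ls_law i) (f := fun x : R => (Num.max 0%R x ^+ 2)%:E)).
- by apply: eq_integral => w _; rewrite expr2.
- by apply/measurable_EFinP/measurable_funX; exact: measurable_maxr.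
- by move=> x; rewrite lee_fin sqr_ge0.
Qed.

Let integral_indepM (f g : T -> R) :
  measurable_fun setT f -> measurable_fun setT g ->
  (forall w, 0 <= f w)%R -> (forall w, 0 <= g w)%R ->
  (forall B, measurable B -> sigma_of setT (fun n w => Ls n w) (f @^-1` B)) ->
  (forall B, measurable B -> sigma_of setT (fun n w => tau n w) (g @^-1` B)) ->
  \int[P]_w (f w * g w)%:E = \int[P]_w (f w)%:E * \int[P]_w (g w)%:E.
Proof.
move=> mf mg f0 g0 sf sg.
pose F : {RV P >-> R} := mfun_Sub (mem_set mf : _ \in mfun).
pose G : {RV P >-> R} := mfun_Sub (mem_set mg : _ \in mfun).
apply: (@ge0_integral_indepM _ _ _ P F G) => // A B mA mB.
by rewrite setIC muleC; apply: tau_Ls_indep; [exact: sg|exact: sf].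
Qed.

Let integral_pair i j :
  \int[P]_w ((rate i w * rate j w) * (gap i w * gap j w))%:E =
  (c ^+ 2 + (i == j)%:R * v)%:E * \int[P]_w (gap i w * gap j w)%:E.
Proof.
rewrite -integral_rate2; apply: integral_indepM.
- exact: measurable_funM.
- exact: measurable_funM.
- by move=> w; rewrite mulr_ge0.
- by move=> w; rewrite mulr_ge0.
- move=> B mB; apply: sigma_of_preimage => //.
  by apply: measurable_funM; apply: measurable_maxr => //;
    exact: (@measurable_fun_generated _ _ _ _ _ (fun n w => Ls n w)).
- move=> B mB; apply: sigma_of_preimage => //.
  by apply: measurable_funM; apply: measurable_gap_gen => k;
    exact: (@measurable_fun_generated _ _ _ _ _ (fun n w => tau n w)).
Qed.

Let integral_term j :
  \int[P]_w (rate j w * gap j w)%:E = c%:E * \int[P]_w (gap j w)%:E.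
Proof.
rewrite -(integral_rate j); apply: integral_indepM => //.
- move=> B mB; apply: sigma_of_preimage => //.
  by apply: measurable_maxr => //;
    exact: (@measurable_fun_generated _ _ _ _ _ (fun n w => Ls n w)).
- move=> B mB; apply: sigma_of_preimage => //.
  by apply: measurable_gap_gen => k;
    exact: (@measurable_fun_generated _ _ _ _ _ (fun n w => tau n w)).
Qed.

Let c_ge0 : (0 <= c)%R.
Proof. by have [] := variance_nonneg L_ge0 L_var. Qed.

Let v_ge0 : (0 <= v)%R.
Proof. by rewrite fine_ge0// variance_ge0. Qed.

Let integral_X1 n :
  \int[P]_w (X n w ^+ 1)%:E = c%:E * \int[P]_w (S n w ^+ 1)%:E.
Proof.
under eq_integral do rewrite expr1 -sumEFin.
under [in RHS]eq_integral do rewrite expr1 -sumEFin.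
rewrite !ge0_integral_sum//.
- rewrite ge0_sume_distrr; first by apply: eq_bigr => j _; exact: integral_term.
  by move=> j _; apply: integral_ge0 => w _; rewrite lee_fin.
- by move=> j; exact/measurable_EFinP.
- by move=> j w _; rewrite lee_fin.
- by move=> j; apply/measurable_EFinP; exact: measurable_funM.
- by move=> j w _; rewrite lee_fin mulr_ge0.
Qed.

Let integral_sum_sqr n (f : nat -> T -> R) :
  (forall j, measurable_fun setT (f j)) -> (forall j w, 0 <= f j w)%R ->
  \int[P]_w ((\sum_(j < n) f j w) ^+ 2)%:E =
  \sum_(i < n) \sum_(j < n) \int[P]_w (f i w * f j w)%:E.
Proof.
move=> mf f0.
have mff i j : measurable_fun setT (fun w => (f i w * f j w)%:E).
  by apply/measurable_EFinP; exact: measurable_funM.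
have ff0 i j w : 0 <= (f i w * f j w)%:E by rewrite lee_fin mulr_ge0.
transitivity (\int[P]_w \sum_(i < n) \sum_(j < n) (f i w * f j w)%:E).
  apply: eq_integral => w _; rewrite expr2 big_distrlr/= -sumEFin.
  by apply: eq_bigr => i _; rewrite -sumEFin.
rewrite ge0_integral_sum//; last 2 first.
- by move=> i; apply: emeasurable_sum => j.
- by move=> i w _; apply: sume_ge0 => j _.
by apply: eq_bigr => i _; rewrite ge0_integral_sum.
Qed.

(** In the expanded square, c^2 occurs for every pair of indices and v only on the diagonal; the c^2
    parts recombine into the square of [S n]. *)
Let integral_X2 n : \int[P]_w (X n w ^+ 2)%:E =
  (c ^+ 2)%:E * \int[P]_w (S n w ^+ 2)%:E +
  v%:E * \sum_(j < n) sqr_gap tau t j.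
Proof.
have e0 i j : 0 <= \int[P]_w (gap i w * gap j w)%:E.
  by apply: integral_ge0 => w _; rewrite lee_fin mulr_ge0.
have mf j : measurable_fun setT (fun w => rate j w * gap j w)%R.
  exact: measurable_funM.
have f0 j w : (0 <= rate j w * gap j w)%R by rewrite mulr_ge0.
rewrite (integral_sum_sqr n mf f0).
rewrite integral_sum_sqr// ge0_sume_distrr; last first.
  by move=> i _; apply: sume_ge0.
rewrite ge0_sume_distrr; last by move=> j _; exact: sqr_gap_ge0.
rewrite -big_split/=; apply: eq_bigr => i _.
rewrite ge0_sume_distrr// (bigD1 i)//= [in RHS](bigD1 i)//=.
under eq_integral do rewrite mulrACA.
rewrite integral_pair eqxx mul1r EFinD ge0_muleDl ?lee_fin ?sqr_ge0//.
rewrite -!addeA; congr (_ + _); rewrite addeC; congr (_ + _).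
  apply: eq_bigr => j ji.
  under eq_integral do rewrite mulrACA.
  have ij : (i == j :> nat) = false by apply/negbTE; rewrite eq_sym.
  by rewrite integral_pair ij mul0r addr0.
Qed.

(** A version of the integrated rate I that is measurable as a limit of the [X n] and nonnegative
    everywhere; it equals the integral almost surely. *)
Let cum_rate w := (`|fine (limn (fun n => (X n w)%:E))|)%R.

Let mcum : measurable_fun setT cum_rate.
Proof.
apply: measurableT_comp => //; apply: measurableT_comp; first exact: fine_measurable.
apply: (emeasurable_fun_cvg (fun n => EFin \o X n)) => [n|w _].
  exact/measurable_EFinP.
apply: ereal_nondecreasing_is_cvgn => a b ab.
by rewrite lee_fin; have := nondecreasing_X w 1 ab; rewrite !expr1.
Qed.

Let cum_eventually w (x : R) n0 : (forall n, (n0 <= n)%N -> X n w = x) ->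
  cum_rate w = x.
Proof.
move=> Hx; rewrite /cum_rate (_ : limn _ = x%:E).
  by rewrite ger0_norm //= -(Hx n0).
apply/cvg_lim => //; apply: cvg_near_cst; exists n0 => // n /= n0n.
by rewrite Hx.
Qed.

Let cvg_X k :
  \int[P]_w (X n w ^+ k)%:E @[n --> \oo] --> \int[P]_w (cum_rate w ^+ k)%:E.
Proof.
apply: (@cvg_integral_eventually _ _ _ P (fun n w => X n w ^+ k)%R
  (fun w => cum_rate w ^+ k)%R) => //.
- by move=> n; exact: measurable_funX.
- exact: measurable_funX.
- by move=> n w; rewrite exprn_ge0.
- by move=> w; rewrite exprn_ge0 ?normr_ge0.
- apply: filterS ae_good => w [tau0 ex Ls0].
  have [n0 Hn0] := X_eventually tau0 Ls0 ex.
  by exists n0 => n n0n; rewrite (cum_eventually Hn0) Hn0.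
Qed.

(** The law of the first epoch, tested on the constant 1, identifies this integral with the mean
    interval. *)
Let tail_fin : \int[lebesgue_measure]_(s in `[0%R, +oo[) ccdf xi s < +oo.
Proof.
have := first_epoch_law tau0_law (f := cst 1) (measurable_cst _) (fun=> lee01).
under [in X in _ = X -> _]eq_integral do rewrite mul1e.
move=> <-; rewrite integral_cst// mul1e /= probability_setT mule1.
by rewrite ltry.
Qed.

Let cum1 : \int[P]_w (cum_rate w ^+ 1)%:E = (c * t)%:E.
Proof.
have H : \int[P]_w (X n w ^+ 1)%:E @[n --> \oo] --> (c * t)%:E.
  rewrite (funext integral_X1) -[in X in _ --> X](expr1 t) EFinM.
  by apply: cvgeZl => //; exact: cvg_S.
exact: (cvg_unique _ (cvg_X (k := 1)) H).
Qed.

Let cum2 : \int[P]_w (cum_rate w ^+ 2)%:E =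
  (c ^+ 2 * t ^+ 2 + v * (2 * residual_variance xi t / m))%:E.
Proof.
have H : \int[P]_w (X n w ^+ 2)%:E @[n --> \oo] -->
    (c ^+ 2 * t ^+ 2 + v * (2 * residual_variance xi t / m))%:E.
  rewrite (funext integral_X2) EFinD (EFinM v) (EFinM (c ^+ 2)%R).
  apply: cvgeD => //; first by apply: cvgeZl => //; exact: cvg_S.
  apply: cvgeZl => //; apply: (sum_sqr_gap_cvg xi_ge0 xi_neq0) => //.
  rewrite (first_sqr_gap tau0_law) -(residual_varianceE tail_fin t_ge0).
  by congr (_ + _); exact: integral_sqr_age.
exact: (cvg_unique _ (cvg_X (k := 2)) H).
Qed.

Lemma variance_cumulative_count (N : {RV P >-> nat}) :
  (forall k, measurable_fun setT (fun w => poisson_mass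
     (\int[lebesgue_measure]_(s in `[0, t]) resampled tau Ls s w)%R k)) ->
  (forall k, P (N @^-1` [set k]) = \int[P]_w (poisson_mass
     (\int[lebesgue_measure]_(s in `[0, t]) resampled tau Ls s w)%R k)%:E) ->
  'V_P[(fun w => (N w)%:R)%R] =
  (t * c + 2 * (v / m) * residual_variance xi t)%:E.
Proof.
move=> mpm NP.
have NP' k : P (N @^-1` [set k]) = \int[P]_w (poisson_mass (cum_rate w) k)%:E.
  rewrite NP; apply: ae_eq_integral => //.
  - exact/measurable_EFinP.
  - exact/measurable_EFinP/(measurableT_comp (measurable_poisson_mass k)).
  - apply: filterS ae_good => w [tau0 ex Ls0] _.
    have [n0 Hn0] := X_eventually tau0 Ls0 ex.
    by rewrite /= (cum_eventually Hn0).
have moment j := mixed_poisson_factorial_moment j mcum (fun w => normr_ge0 _) NP'.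
have mN : measurable_fun setT (fun w => (N w)%:R : R).
  exact: (measurableT_comp (f := fun k : nat => k%:R : R) _ (measurable_funPT N)).
have EN : \int[P]_w ((N w)%:R)%:E = (c * t)%:E :> \bar R.
  rewrite -cum1 -moment; apply: eq_integral => w _.
  by rewrite ffactn1.
(* N^2 = N + N(N - 1) reduces the second moment to the two factorial moments. *)
have EN2 : \int[P]_w ((N w)%:R ^+ 2)%:E =
    (c * t)%:E + (c ^+ 2 * t ^+ 2 + v * (2 * residual_variance xi t / m))%:E :> \bar R.
  rewrite -cum2 -moment -EN -ge0_integralD//.
  - apply: eq_integral => w _; rewrite -EFinD -natrX -natrD; congr (_%:R%:E).
    by rewrite ffactnS ffactn1; case: (N w) => //= k; rewrite -mulnn mulnS.
  - exact/measurable_EFinP.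
  - apply/measurable_EFinP.
    exact: (measurableT_comp (f := fun k : nat => (k ^_ 2)%:R : R) _ (measurable_funPT N)).
rewrite varianceE; last by apply: Lfun2_sqr_lty; rewrite // EN2 -EFinD ltry.
rewrite expectation.unlock EN.
rewrite (_ : \int[P]_w _ = \int[P]_w ((N w)%:R ^+ 2)%:E)// EN2.
rewrite -EFin_expe -EFinD; congr (_%:E).
have m_neq0 : m != 0%R by rewrite gt_eqF// (mean_interval_gt0 tau0_law).
by field.
Qed.

End cumulative_count.

(** * From the conditional Poisson process to the law of one count *)

Section poisson_given_rates.
Context d (T : measurableType d) (R : realType) (P : probability T R).

Lemma measurable_resampled (tau Ls : nat -> {RV P >-> R}) s :
  measurable_fun setT (resampled tau Ls s).
Proof.
move=> _ B mB; rewrite setTI.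
have mFP n : measurable [set w | first_passage tau s w n].
  have -> : [set w | first_passage tau s w n] =
      \bigcap_(k in [set k | (k < n)%N]) (epoch tau k.+1 @^-1` `]-oo, s]) `&`
      (epoch tau n.+1 @^-1` `]s, +oo[).
    apply/seteqP; split=> w /=.
      move=> [H1 H2]; split=> [k /= kn|]; rewrite /= in_itv/= ?andbT//.
      exact: H1.
    rewrite in_itv/= andbT => -[H1 H2]; split=> //.
  apply: measurableI.
    apply: bigcap_measurableType => // k _.
    by rewrite -[X in measurable X]setTI; exact: measurable_epoch.
  by rewrite -[X in measurable X]setTI; exact: measurable_epoch.
have mnb n : measurable [set w | nb_resamplings tau s w = n].
  (* The default value of [xget] adds to the case n = 0 the event that no first passage exists. *)
  have -> : [set w | nb_resamplings tau s w = n] =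
      [set w | first_passage tau s w n] `|`
      (if n == 0%N then ~` \bigcup_j [set w | first_passage tau s w j] else set0).
    apply/seteqP; split=> w /=.
      rewrite /nb_resamplings; case: xgetP => [j -> Hj <-|Hno <-]; first by left.
      by right => -[j _]; exact: Hno.
    move=> [Hn|]; first by apply: (xget_unique _ Hn) => j Hj; exact: first_passage_unique Hj Hn.
    case: eqP => // -> Hno; rewrite /nb_resamplings; case: xgetP => // j _ Hj.
    by case: Hno; exists j.
  apply: measurableU => //; case: ifP => // _.
  by apply: measurableC; exact: bigcupT_measurable.
rewrite (_ : _ @^-1` B =
  \bigcup_n ([set w | nb_resamplings tau s w = n] `&` Ls n @^-1` B)).
  apply: bigcupT_measurable => n; apply: measurableI => //.
  by rewrite -[X in measurable X]setTI; exact: measurable_funPT.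
apply/seteqP; split=> w /=.
  by move=> Bw; exists (nb_resamplings tau s w).
by move=> [n _ [<-]].
Qed.

(** The defining property is taken for the single increment from 0 to [t] and for the whole space as
    conditioning event. Almost surely the path starts at 0, so this increment is the count
    itself. *)
Lemma cond_poisson_count (G : set (set T)) (N : R -> {RV P >-> nat})
    (lam : R -> T -> R) (t : R) k :
  G setT -> G `<=` measurable ->
  cond_poisson_process P G (fun s w => N s w) lam -> 0 <= t ->
  measurable_fun setT (fun w => poisson_mass
    (\int[lebesgue_measure]_(s in `[0, t]) lam s w) k) /\
  P (N t @^-1` [set k]) = (\int[P]_w (poisson_mass
    (\int[lebesgue_measure]_(s in `[0, t]) lam s w) k)%:E)%E.
Proof.
move=> GT Gm [Npath Npois] t0.
pose q w := poisson_mass (\int[lebesgue_measure]_(s in `[0, t]) lam s w) k.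
have t01 i : (i < 1)%N -> (if i is 0%N then 0 else t) <= t by case: i.
have := Npois 1%N (fun i => if i is 0%N then 0 else t) (fun=> k) (lexx 0) t01.
rewrite (_ : (fun w => \prod_(i < 1) _) = q); last first.
  by apply/funext => w; rewrite big_ord1.
move=> [mq /(_ setT GT)]; rewrite setIT; set E := [set w | _] => qE.
split; first by move=> _ B mB; rewrite setTI; apply: Gm; exact: mq.
rewrite [RHS]qE.
have mN s j : measurable (N s @^-1` [set j]).
  by rewrite -[X in measurable X]setTI; exact: measurable_funPT.
have mE : measurable E.
  rewrite (_ : E = \bigcup_j (N 0 @^-1` [set j] `&` N t @^-1` [set (j + k)%N])).
    by apply: bigcupT_measurable => j; exact: measurableI.
  apply/seteqP; split=> w.
    by move=> /(_ 0%N isT) Ew; exists (N 0 w).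
  by move=> [j _ [/= Nj Njk]] [|//] _; rewrite Njk Nj.
rewrite -(setIT (N t @^-1` _)) -(setIT E) -!integral_indic//.
apply: ae_eq_integral => //; try exact/measurable_EFinP/measurable_indic.
apply: filterS Npath => w [N0 _ _] _; rewrite /= !indicE.
congr ((nat_of_bool _)%:R%:E); apply/idP/idP; rewrite !inE /E /=.
  by move=> Nk [|//] _; rewrite N0 add0n.
by move=> /(_ 0%N isT); rewrite N0 add0n.
Qed.

End poisson_given_rates.

(** * Passing from the rate pairs to one coordinate *)

Section resampled_rates.
Context d (T : measurableType d) (R : realType) (P : probability T R).
Variables (xi : {RV P >-> R}) (tau : nat -> {RV P >-> R}).
Hypothesis xi_ge0 : {ae P, forall w, 0 <= xi w}.
Hypothesis xi_density : exists f : R -> R, has_density P xi f.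
Hypothesis tau_indep : mutually_independent P (fun n w => tau n w).
Hypothesis tau0_law : has_density P (tau 0%N) (residual_density xi).
Hypothesis tau_law : forall n, same_law P (tau n.+1) xi.

Lemma density_neq0 : P (xi @^-1` [set 0]) = 0%E.
Proof.
have [f [_ _ ->//]] := xi_density.
by rewrite integral_set1.
Qed.

Variables (Lambda M : {RV P >-> R}) (Lambdas Ms : nat -> {RV P >-> R}).
Hypothesis rates_indep :
  mutually_independent P (fun n w => (Lambdas n w, Ms n w)).
Hypothesis rates_law : forall n,
  same_law P (fun w => (Lambdas n w, Ms n w)) (fun w => (Lambda w, M w)).
Hypothesis tau_rates_indep : independent_systems P
  (sigma_of setT (fun n w => tau n w))
  (sigma_of setT (fun n w => (Lambdas n w, Ms n w))).

(** [p] stands for either projection, so that arrivals and services share one proof; law and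
    independence of the pairs pass to the coordinate by taking preimages under [p]. *)
Lemma rate_variance (p : R * R -> R) (L : {RV P >-> R})
    (Ls : nat -> {RV P >-> R}) (G : set (set T)) (N : R -> {RV P >-> nat}) t :
  measurable_fun setT p -> (forall w, L w = p (Lambda w, M w)) ->
  (forall n w, Ls n w = p (Lambdas n w, Ms n w)) ->
  {ae P, forall w, 0 <= L w} -> ('V_P[L] < +oo)%E ->
  G setT -> G `<=` measurable ->
  cond_poisson_process P G (fun s w => N s w) (resampled tau Ls) -> 0 <= t ->
  'V_P[(fun w => (N t w)%:R)%R] =
    (t * fine 'E_P[L]%E + 2 * (fine 'V_P[L] / fine 'E_P[xi]%E) *
     residual_variance xi t)%:E.
Proof.
move=> mp LE LsE L0 Lv GT Gm NG t0.
have mpB B : measurable B -> measurable (p @^-1` B).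
  by move=> mB; rewrite -[X in measurable X]setTI; exact: mp.
have LsP n B : Ls n @^-1` B = (fun w => (Lambdas n w, Ms n w)) @^-1` (p @^-1` B).
  by apply/seteqP; split=> w /=; rewrite LsE.
apply: (@variance_cumulative_count _ _ _ P xi L tau Ls) => //.
- exact: density_neq0.
- move=> n B mB; rewrite LsP rates_law; last exact: mpB.
  by congr (P _); apply/seteqP; split=> w /=; rewrite LE.
- move=> i j ij A B mA mB.
  have := rates_indep [fset i; j]%fset
    (B := fun k => if k == i then p @^-1` A else p @^-1` B) _.
  rewrite big_fsetU1/= ?in_fset1// big_seq_fset1 eqxx eq_sym (negbTE ij) !LsP.
  move=> <-; last by move=> k; case: ifP => _; exact: mpB.
  congr (P _); apply/seteqP; split=> w /=.
    move=> [Aw Bw] k /=; rewrite !inE => /orP[/eqP->|/eqP->]; first by rewrite eqxx.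
    by rewrite eq_sym (negbTE ij).
  move=> Hw; split.
    by have := Hw i; rewrite /= !inE eqxx => /(_ isT).
  by have := Hw j; rewrite /= !inE eqxx orbT eq_sym (negbTE ij) => /(_ isT).
- move=> E1 E2 HE1 HE2; apply: tau_rates_indep => //.
  (* The sigma-algebra of one coordinate is contained in that of the pairs, since its generators
     are. *)
  move: HE2; apply: smallest_sub; first exact: smallest_sigma_algebra.
  move=> _ [n _ [B mB <-]]; rewrite setTI LsP; apply: sub_sigma_algebra.
  by exists n => //; exists (p @^-1` B); [exact: mpB|rewrite setTI].
- by move=> k; have [] := cond_poisson_count k GT Gm NG t0.
- by move=> k; have [] := cond_poisson_count k GT Gm NG t0.
Qed.

End resampled_rates.

Theorem proposition4p1 (R : realType) (d : measure_display)
  (T : measurableType d) (P : probability T R)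
  (* generic interval and generic (arrival rate, service rate) pair *)
  (xi Lambda M : {RV P >-> R})
  (* intervals between resamplings, and successively drawn rates *)
  (tau Lambdas Ms : nat -> {RV P >-> R})
  (* cumulative arrivals and potential services *)
  (A S : R -> {RV P >-> nat})
  (xi_ge0 : {ae P, forall w, 0 <= xi w})
  (xi_density : exists f : R -> R, has_density P xi f)
  (xi_mean : ('E_P[xi] < +oo)%E)
  (xi_moment2 : ('E_P[(fun w => xi w ^+ 2)%R] < +oo)%E)
  (rates_ge0 : {ae P, forall w, 0 <= Lambda w /\ 0 <= M w})
  (Lambda_var : ('V_P[Lambda] < +oo)%E)
  (M_var : ('V_P[M] < +oo)%E)
  (tau_indep : mutually_independent P (fun n w => tau n w))
  (tau0_law : has_density P (tau 0%N) (residual_density xi))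
  (tau_law : forall n, same_law P (tau n.+1) xi)
  (rates_indep : mutually_independent P (fun n w => (Lambdas n w, Ms n w)))
  (rates_law : forall n,
     same_law P (fun w => (Lambdas n w, Ms n w)) (fun w => (Lambda w, M w)))
  (tau_rates_indep : independent_systems P
     (sigma_of setT (fun n w => tau n w))
     (sigma_of setT (fun n w => (Lambdas n w, Ms n w)))) :
  let lam : R -> T -> R := resampled tau Lambdas in
  let mu : R -> T -> R := resampled tau Ms in
  let G := sigma_of `[0, +oo[ (fun t w => (lam t w, mu t w)) in
  cond_poisson_process P G A lam ->
  cond_poisson_process P G S mu ->
  cond_independent P G (sigma_of `[0, +oo[ (fun t w => A t w))
                       (sigma_of `[0, +oo[ (fun t w => S t w)) ->
  forall t : R, 0 <= t ->
  'V_P[(fun w => (A t w)%:R)%R] =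
    (t * fine 'E_P[Lambda]%E +
     2 * (fine 'V_P[Lambda] / fine 'E_P[xi]%E) *
     (\int[lebesgue_measure]_(u in `[0, t])
         ((t * u - 2^-1 * u ^+ 2) * fine (ccdf xi u)) +
      2^-1 * t ^+ 2 *
      \int[lebesgue_measure]_(u in `[t, +oo[) fine (ccdf xi u)))%:E /\
  'V_P[(fun w => (S t w)%:R)%R] =
    (t * fine 'E_P[M]%E +
     2 * (fine 'V_P[M] / fine 'E_P[xi]%E) *
     (\int[lebesgue_measure]_(u in `[0, t])
         ((t * u - 2^-1 * u ^+ 2) * fine (ccdf xi u)) +
      2^-1 * t ^+ 2 *
      \int[lebesgue_measure]_(u in `[t, +oo[) fine (ccdf xi u)))%:E.
Proof.
move=> lam mu G Alam Smu _ t t0.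
have GT : G setT by exact: (@measurableT _ (g_sigma_algebraType _)).
have Gm : G `<=` measurable.
  apply: sigma_of_measurable => s _.
  by apply: measurable_fun_pair; exact: measurable_resampled.
have m1 : measurable_fun setT (@fst R R) by exact: measurable_fst.
have m2 : measurable_fun setT (@snd R R) by exact: measurable_snd.
have L0 : {ae P, forall w, 0 <= Lambda w} by apply: filterS rates_ge0 => w [].
have M0 : {ae P, forall w, 0 <= M w} by apply: filterS rates_ge0 => w [].
split.
- exact: (rate_variance xi_ge0 xi_density tau_indep tau0_law tau_law rates_indep
    rates_law tau_rates_indep m1 (fun=> erefl) (fun _ _ => erefl) L0
    Lambda_var GT Gm Alam t0).
- exact: (rate_variance xi_ge0 xi_density tau_indep tau0_law tau_law rates_indep
    rates_law tau_rates_indep m2 (fun=> erefl) (fun _ _ => erefl) M0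
    M_var GT Gm Smu t0).
Qed.
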